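(* Fix $x_0>0$ and let $\gamma^{\rho,x_0}$ be the chordal $\mathrm{SLE}_0(\rho)$ in $\mathbb H$ from $0$, with reference point $\infty$ and force point $x_0$. Then: (i) If $\rho\in(-\infty,-4]$, then $\gamma^{\rho,x_0}(\tau)=x_0$ and the (outer) hitting angle is $\alpha\pi=\pi\frac{4+\rho}{2+\rho}$. Moreover the hitting time is $\tau=-\frac{x_0^2}{2(2+\rho)}$. (ii) If $\rho\in(-4,-2)$, then $\gamma^{\rho,x_0}(\tau)=-\frac{2}{\rho+2}x_0>x_0$ and the (outer) hitting angle is $\alpha\pi=\pi\frac{4+\rho}{2}$. Moreover the hitting time is $\tau=-\frac{x_0^2}{2(2+\rho)}$. (iii) If $\rho=-2$, then $\gamma^{\rho,x_0}$ approaches $\infty$ asymptotic to $\{x+i\pi x_0:x\in\mathbb R^+\}$. (iv) If $\rho\in(-2,\infty)$, then $\gamma^{\rho,x_0}$ approaches $\infty$ at an angle $\alpha\pi=\pi\frac{2+\rho}{4+\rho}$.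
   Context: $\mathbb H$ is the upper half-plane. The chordal $\mathrm{SLE}_0(\rho)$ from $0$ with reference point $\infty$ and force point $x_0$ is the curve whose (half-plane capacity) driving function solves $\dot W_t=\frac{\rho}{W_t-x_t}$, $W_0=0$, with $x_t=g_t(x_0)$, $\partial_tg_t(z)=\frac2{g_t(z)-W_t}$, $g_0(z)=z$, and $\gamma(t)=\lim_{y\to0+}g_t^{-1}(W_t+iy)$, run up to $\tau_{0+}=\lim_{\varepsilon\to0+}\inf\{t:|W_t-x_t|=\varepsilon\}$. In (i) and (ii), $\tau=\tau_{0+}$ is the time at which the curve terminates on the real line, and $\gamma(\tau)$ is the limit of $\gamma(t)$ as $t\to\tau-$. The outer hitting angle is the angle at $\gamma(\tau)$ between the curve and the half-line $[\gamma(\tau),\infty)$, measured in the unbounded component of $\mathbb H\setminus\gamma$. In (iv), approaching $\infty$ at an angle $\alpha\pi$ means $\gamma(t)\to\infty$ with $\arg\gamma(t)\to\alpha\pi$. *)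

(* Defs.v *)
From Stdlib Require Import Reals.
From Coquelicot Require Import Coquelicot.

Open Scope R_scope.

(* Derivative along the set [D]: one-sided at an end point of an interval,
   [is_derive] at an interior point. *)
Definition is_derive_on {V : NormedModule R_AbsRing} (D : R -> Prop)
    (f : R -> V) (t : R) (l : V) : Prop :=
  filterdiff f (within D (locally t)) (fun h : R => scal h l).

(* The interval [0, tau), where [tau] may be infinite. *)
Definition before (tau : Rbar) (t : R) : Prop := 0 <= t /\ Rbar_lt t tau.

(* The filter of "t -> tau-", including tau = +oo. *)
Definition left_of (tau : Rbar) : (R -> Prop) -> Prop :=
  within (fun t : R => Rbar_lt t tau) (Rbar_locally tau).

(* Neighbourhoods in the extended line, whose elements are predicates on [Rbar];
   [Rbar_locally] only gives their traces on [R]. *)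
Definition Rbar_nhds (l : Rbar) (P : Rbar -> Prop) : Prop :=
  match l with
  | Finite r => locally r (fun y : R => P (Finite y))
  | p_infty => exists M : R, forall y : Rbar, Rbar_lt M y -> P y
  | m_infty => exists M : R, forall y : Rbar, Rbar_lt y M -> P y
  end.

(* Principal argument: in [0, PI] on the closed upper half-plane. *)
Definition Arg (z : C) : R :=
  if Rle_dec 0 (Im z) then acos (Re z / Cmod z) else - acos (Re z / Cmod z).

(* [h s = g_s(z)] for all [s] in the time interval [D] (an interval containing 0);
   in particular [z] is not swallowed during [D]. *)
Definition loewner_path (W : R -> R) (D : R -> Prop) (z : C) (h : R -> C) : Prop :=
  h 0 = z /\
  forall s : R, D s ->
    h s <> RtoC (W s) /\
    is_derive_on (V := C_R_NormedModule) D h s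
      (Cdiv (RtoC 2) (Cminus (h s) (RtoC (W s)))).

(* [g_t(z) = w]. *)
Definition loewner_map (W : R -> R) (t : R) (z w : C) : Prop :=
  exists h : R -> C,
    loewner_path W (fun s : R => 0 <= s <= t) z h /\ h t = w.

(* [c] is the limit of [g_t^{-1}(W_t + i y)] as [y] decreases to 0; here [f y] is
   the preimage, which is unique since solutions of the Loewner equation are. *)
Definition loewner_tip (W : R -> R) (t : R) (c : C) : Prop :=
  exists f : R -> C,
    (forall y : R, 0 < y ->
       0 < Im (f y) /\ loewner_map W t (f y) (W t, y)) /\
    filterlim f (at_right 0) (locally c).

(* inf {t : |W_t - x_t| = eps} over the life time [0, tau); +oo if there is none. *)
Definition hitting_time (tau : Rbar) (W x : R -> R) (eps : R) : Rbar :=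
  Glb_Rbar (fun t : R => before tau t /\ Rabs (W t - x t) = eps).

(* Chordal SLE_0(rho) from 0 with reference point oo and force point [x0]: driving
   function [W], image [x] of the force point, and trace [gamma], all run on
   [0, tau).  The last field says that [tau] is tau_{0+}; an interval that stops
   too early is excluded, because there the hitting times of small [eps] are +oo. *)
Record SLE0 (rho x0 : R) (tau : Rbar) (W x : R -> R) (gamma : R -> C) : Prop := {
  SLE0_start : W 0 = 0;
  SLE0_force : loewner_path W (before tau) (RtoC x0) (fun t : R => RtoC (x t));
  SLE0_drive : forall t : R, before tau t ->
    is_derive_on (V := R_NormedModule) (before tau) W t (rho / (W t - x t));
  SLE0_trace : forall t : R, before tau t -> loewner_tip W t (gamma t);
  SLE0_time : filterlim (hitting_time tau W x) (at_right 0) (Rbar_nhds tau)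
}.

(* [z] lies in an unbounded component of [S].  Components are taken with respect to
   paths; for open subsets of the plane these are the connected components. *)
Definition in_unbounded_component (S : C -> Prop) (z : C) : Prop :=
  forall M : R, exists (w : C) (p : R -> C),
    M < Cmod w /\
    p 0 = z /\ p 1 = w /\
    forall s : R, 0 <= s <= 1 ->
      S (p s) /\ filterlim p (within (fun u : R => 0 <= u <= 1) (locally s)) (locally (p s)).

Definition complement_of_trace (tau : Rbar) (gamma : R -> C) (z : C) : Prop :=
  0 < Im z /\ forall t : R, before tau t -> gamma t <> z.

(* Angle at the boundary point [p] between the curve, as it arrives at [p], and the
   half-line [p, oo).  The second clause says on which side of the curve the angle
   is measured: the sector that it spans near [p] lies in the unbounded component of
   the complement of the curve. *)
Definition outer_hitting_angle (tau : Rbar) (gamma : R -> C) (p theta : R) : Prop :=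
  (left_of tau (fun t : R => gamma t <> RtoC p) /\
   filterlim (fun t : R => Arg (Cminus (gamma t) (RtoC p))) (left_of tau) (locally theta)) /\
  forall eps : R, 0 < eps ->
    exists r : R, 0 < r /\
      forall z : C,
        0 < Cmod (Cminus z (RtoC p)) < r ->
        0 < Arg (Cminus z (RtoC p)) < theta - eps ->
        in_unbounded_component (complement_of_trace tau gamma) z.

Definition approaches_infinity (tau : Rbar) (gamma : R -> C) : Prop :=
  filterlim (fun t : R => Cmod (gamma t)) (left_of tau) (Rbar_locally p_infty).

Definition asymptotic_to (tau : Rbar) (gamma : R -> C) (L : C -> Prop) : Prop :=
  forall eps : R, 0 < eps ->
    left_of tau (fun t : R => exists z : C, L z /\ Cmod (Cminus (gamma t) z) < eps).

(* Main.v *)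
Require Import Defs.
From Stdlib Require Import Reals Lra Classical.
From Coquelicot Require Import Coquelicot.
Open Scope R_scope.

(** Put [a = rho + 2] and [X = x - W].  The force point equation and the driving equation
    give [X' = a / X], hence [X_t^2 = x0^2 + 2 a t].  For [a < 0] the gap [X] closes at the
    time [- x0^2 / (2 a)], and for [a >= 0] it never closes; since [tau] is the limit of the
    hitting times of small gaps, this determines [tau].

    For a point of the upper half-plane, [Z = g(z) - W] solves
    [Z' = 2 / Z + (a - 2) / X], and a direct computation shows that
    [a log (Z - X) + 2 log (Z + 2 X / a)] is constant in time.  A point of the trace is a
    limit of points that are mapped to [W_t + i y] with [y -> 0+], that is, with [Z -> 0].
    The trace therefore solves
    [a log (z - x0) + 2 log (z + 2 x0 / a) = a log (- X) + 2 log (2 X / a)]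
    (lemma [trace_equation]).  The imaginary part says that the trace lies on a level line
    of [a Arg (z - x0) + 2 Arg (z + 2 x0 / a)], and the real part says where on this line
    the tip is.

    - For [a < 0], [a <> -2], the real part forces the tip to the singular point whose
      logarithm has the larger coefficient in absolute value ([x0] for [a < -2],
      [- 2 x0 / a] for [a > -2]) as [X -> 0].  The argument about the other singular point
      tends to [0], so that the imaginary part gives the hitting angle.  The argument about the landing point is
      never below its limit along the curve, and straight rays from that point through the
      outer sector escape to infinity without meeting the curve (lemma [landing]).
    - For [a > 0], [X -> oo] forces the tip to infinity, where both arguments agree with
      [Arg z] in the limit (lemma [escape_at_angle]).
    - For [a = -2] the two logarithms cancel; the conserved quantity is
      [log (Z - X) - X / (Z - X)] (lemmas [trace_equation_am2] and [landing_pole]).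
    - For [a = 0] the second singular point is at infinity; [X] is constant, and
      [(Z - X) + X log (Z - X) + 2 t / X] is conserved (lemmas [trace_equation_a0] and
      [escape_along_line]). *)

(** * Derivatives along a set, and functions with zero derivative *)

Lemma is_derive_on_fst :
  forall (D : R -> Prop) (h : R -> C) (s : R) (l : C),
    is_derive_on (V := C_R_NormedModule) D h s l ->
    is_derive_on (V := R_NormedModule) D (fun u => Re (h u)) s (Re l).
Proof.
  intros D h s l [_ H]. split.
  - apply (is_linear_scal_l (K := R_AbsRing) (V := R_NormedModule) (Re l)).
  - intros y Hy eps. generalize (H y Hy eps). apply filter_imp. intros z Hz.
    eapply Rle_trans; [|apply Hz].
    eapply Rle_trans; [|apply (norm_prod (K := R_AbsRing) (U := R_NormedModule)
                                         (V := R_NormedModule))].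
    eapply Rle_trans; [|apply Rmax_l]. apply Req_le. reflexivity.
Qed.

Lemma is_derive_on_snd :
  forall (D : R -> Prop) (h : R -> C) (s : R) (l : C),
    is_derive_on (V := C_R_NormedModule) D h s l ->
    is_derive_on (V := R_NormedModule) D (fun u => Im (h u)) s (Im l).
Proof.
  intros D h s l [_ H]. split.
  - apply (is_linear_scal_l (K := R_AbsRing) (V := R_NormedModule) (Im l)).
  - intros y Hy eps. generalize (H y Hy eps). apply filter_imp. intros z Hz.
    eapply Rle_trans; [|apply Hz].
    eapply Rle_trans; [|apply (norm_prod (K := R_AbsRing) (U := R_NormedModule)
                                         (V := R_NormedModule))].
    eapply Rle_trans; [|apply Rmax_r]. apply Req_le. reflexivity.
Qed.

Lemma is_derive_on_continuous :
  forall (D : R -> Prop) (f : R -> R) (s l : R),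
    is_derive_on (V := R_NormedModule) D f s l ->
    filterlim f (within D (locally s)) (locally (f s)).
Proof.
  intros D f s l [_ H]. apply filterlim_locally. intros eps.
  assert (Hs : is_filter_lim (within D (locally s)) s)
    by (intros P HP; unfold within; generalize HP; apply filter_imp; auto).
  specialize (H s Hs (mkposreal 1 Rlt_0_1)). simpl in H.
  assert (Hl : 0 < Rabs l + 1) by (generalize (Rabs_pos l); lra).
  assert (He : 0 < eps / (Rabs l + 1))
    by (apply Rdiv_lt_0_compat; [apply cond_pos | exact Hl]).
  assert (Hb : within D (locally s) (ball s (mkposreal _ He)))
    by (apply Hs, locally_ball).
  generalize (filter_and _ _ H Hb). apply filter_imp. intros z [Hz Hz'].
  change (Rabs ((f z + - f s) + - ((z + - s) * l)) <= 1 * Rabs (z + - s)) in Hz.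
  change (Rabs (z + - s) < eps / (Rabs l + 1)) in Hz'.
  change (Rabs (f z + - f s) < eps).
  replace (f z + - f s) with ((f z + - f s + - ((z + - s) * l)) + (z + - s) * l) by ring.
  eapply Rle_lt_trans; [apply Rabs_triang|]. rewrite Rabs_mult.
  apply Rle_lt_trans with (Rabs (z + - s) * (Rabs l + 1)); [lra|].
  apply Rlt_le_trans with (eps / (Rabs l + 1) * (Rabs l + 1)).
  - apply Rmult_lt_compat_r; assumption.
  - right. field. lra.
Qed.

Lemma is_derive_on_interior :
  forall (D : R -> Prop) (f : R -> R) (s l : R),
    locally s D ->
    is_derive_on (V := R_NormedModule) D f s l -> is_derive f s l.
Proof.
  intros D f s l HD [_ H]. split.
  - apply (is_linear_scal_l (K := R_AbsRing) (V := R_NormedModule) l).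
  - intros y Hy eps.
    assert (Hy' : is_filter_lim (within D (locally s)) y)
      by (intros P HP; unfold within; generalize (Hy P HP); apply filter_imp; auto).
    generalize (filter_and _ _ HD (H y Hy' eps)). apply filter_imp.
    intros z [Hz Hz']. exact (Hz' Hz).
Qed.

(** The point of the interval [0, t] nearest to [s], for [t >= 0].  Composing with it
    extends a function on that interval to the whole line and keeps its continuity. *)
Definition clamp (t s : R) : R := Rmax 0 (Rmin s t).

Lemma clamp_in : forall t s, 0 <= t -> 0 <= clamp t s <= t.
Proof.
  intros t s Ht. unfold clamp, Rmax, Rmin.
  destruct (Rle_dec s t); destruct (Rle_dec 0 _); lra.
Qed.

Lemma clamp_id : forall t s, 0 <= s <= t -> clamp t s = s.
Proof.
  intros t s Hs. unfold clamp. rewrite Rmin_left by lra. apply Rmax_right. lra.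
Qed.

Lemma clamp_lipschitz :
  forall t s u, 0 <= t -> Rabs (clamp t u - clamp t s) <= Rabs (u - s).
Proof.
  intros t s u Ht. unfold clamp, Rmax, Rmin.
  destruct (Rle_dec u t); destruct (Rle_dec s t);
    repeat destruct (Rle_dec 0 _); unfold Rabs; repeat destruct (Rcase_abs _); lra.
Qed.

Lemma clamp_continuous :
  forall (f : R -> R) (t : R), 0 <= t ->
    (forall s, 0 <= s <= t ->
       filterlim f (within (fun u => 0 <= u <= t) (locally s)) (locally (f s))) ->
    forall s, continuous (fun u => f (clamp t u)) s.
Proof.
  intros f t Ht H s.
  apply filterlim_comp with (2 := H (clamp t s) (clamp_in t s Ht)).
  intros P [d Hd]. exists d. intros u Hu. apply Hd.
  - eapply Rle_lt_trans; [apply (clamp_lipschitz t s u Ht)|]. exact Hu.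
  - apply clamp_in, Ht.
Qed.

Lemma locally_open_interval : forall a b s : R, a < s < b -> locally s (fun u => a < u < b).
Proof.
  intros a b s Hs. apply filter_and.
  - apply open_gt. lra.
  - apply open_lt. lra.
Qed.

Lemma clamp_derive :
  forall (f : R -> R) (t s l : R), 0 < s < t -> is_derive f s l ->
    is_derive (fun u => f (clamp t u)) s l.
Proof.
  intros f t s l Hs H. apply is_derive_ext_loc with (2 := H).
  generalize (locally_open_interval 0 t s Hs). apply filter_imp.
  intros u Hu. rewrite clamp_id by lra. reflexivity.
Qed.

Lemma continuous_scal_fun : forall (k : R) (f : R -> R) (s : R),
  continuous f s -> continuous (fun u => k * f u) s.
Proof.
  intros k f s Hf.
  apply (continuous_mult (fun _ => k) f); [apply continuous_const | exact Hf].
Qed.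

Lemma clamp_of_derive_on :
  forall (D : R -> Prop) (f df : R -> R) (t : R), 0 <= t ->
    (forall u, 0 <= u <= t -> D u) ->
    (forall s, D s -> is_derive_on (V := R_NormedModule) D f s (df s)) ->
    (forall s, continuous (fun u => f (clamp t u)) s) /\
    (forall s, 0 < s < t -> is_derive (fun u => f (clamp t u)) s (df s)).
Proof.
  intros D f df t Ht HD Hf. split.
  - apply clamp_continuous; [exact Ht|]. intros s Hs P HP.
    generalize (is_derive_on_continuous D f s _ (Hf s (HD s Hs)) P HP).
    unfold filtermap, within. apply filter_imp. intros u Hu Hu'. apply Hu, HD, Hu'.
  - intros s Hs. apply clamp_derive; [exact Hs|].
    apply is_derive_on_interior with D; [|apply Hf, HD; lra].
    generalize (locally_open_interval 0 t s Hs). apply filter_imp.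
    intros u Hu. apply HD. lra.
Qed.

Lemma constant_of_zero_derivative :
  forall (f : R -> R) (t : R), 0 <= t ->
    (forall s, 0 <= s <= t -> continuous f s) ->
    (forall s, 0 < s < t -> is_derive f s 0) ->
    f t = f 0.
Proof.
  intros f t Ht Hc Hd.
  destruct (MVT_gen f 0 t (fun _ => 0)) as [c [_ Hf]].
  - rewrite Rmin_left, Rmax_right by lra. exact Hd.
  - rewrite Rmin_left, Rmax_right by lra. intros s Hs.
    apply continuity_pt_filterlim, Hc, Hs.
  - lra.
Qed.

(** [V' = - phi V] makes [V] times the exponential of the integral of [phi] constant. *)
Lemma linear_ode_positive :
  forall (phi V : R -> R) (t : R), 0 <= t ->
    (forall s, continuous phi s) -> (forall s, continuous V s) ->
    (forall s, 0 < s < t -> is_derive V s (- phi s * V s)) ->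
    0 < V 0 -> 0 < V t.
Proof.
  intros phi V t Ht Hphi HV HV' H0.
  set (I := fun s => RInt phi 0 s).
  assert (HI : forall s, is_derive I s (phi s)).
  { intros s. apply is_derive_RInt with 0; [|apply Hphi].
    apply filter_forall. intros u. apply (RInt_correct (V := R_CompleteNormedModule)).
    apply (ex_RInt_continuous (V := R_CompleteNormedModule)). intros z _. apply Hphi. }
  assert (HE : forall s, is_derive (fun s => exp (I s)) s (phi s * exp (I s))).
  { intros s. evar_last. apply is_derive_comp; [apply is_derive_exp | apply HI].
    reflexivity. }
  assert (Hc : V t * exp (I t) = V 0 * exp (I 0)).
  { apply (constant_of_zero_derivative (fun s => V s * exp (I s)) t Ht).
    - intros s _. apply (continuous_mult V (fun s => exp (I s))); [apply HV|].
      apply (ex_derive_continuous (fun s => exp (I s))). eexists. apply HE.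
    - intros s Hs. evar_last.
      + apply (is_derive_mult V (fun s => exp (I s))).
        * apply HV', Hs.
        * apply HE.
        * intros; apply Rmult_comm.
      + unfold plus, mult; simpl. ring. }
  assert (He : 0 < exp (I t)) by apply exp_pos.
  assert (H1 : 0 < V 0 * exp (I 0)) by (apply Rmult_lt_0_compat; [exact H0 | apply exp_pos]).
  destruct (Rle_lt_dec (V t) 0) as [Hn|]; [|assumption]. exfalso.
  assert (V t * exp (I t) <= 0).
  { rewrite <- (Rmult_0_l (exp (I t))). apply Rmult_le_compat_r; lra. }
  lra.
Qed.

Lemma positive_of_nonzero :
  forall (f : R -> R) (t : R), 0 <= t ->
    (forall s, continuous f s) -> (forall s, f s <> 0) -> 0 < f 0 -> 0 < f t.
Proof.
  intros f t Ht Hc Hn H0. destruct (Rle_lt_dec (f t) 0) as [H|]; [|assumption].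
  exfalso. destruct (IVT_gen f 0 t 0) as [c [_ Hc0]].
  - intros s. apply continuity_pt_filterlim, Hc.
  - rewrite Rmin_right, Rmax_left by lra. lra.
  - exact (Hn c Hc0).
Qed.

(** * The argument on the closed upper half-plane *)

Lemma Arg_upper : forall z : C, 0 <= Im z -> Arg z = acos (Re z / Cmod z).
Proof.
  intros z Hz. unfold Arg. destruct (Rle_dec 0 (Im z)); [reflexivity | contradiction].
Qed.

Lemma Arg_bounds : forall z : C, 0 <= Im z -> 0 <= Arg z <= PI.
Proof. intros z Hz. rewrite Arg_upper by assumption. apply acos_bound. Qed.

Lemma Re_div_Cmod_bounds : forall z : C, z <> 0 -> -1 <= Re z / Cmod z <= 1.
Proof.
  intros z Hz. apply Cmod_gt_0 in Hz. apply Rabs_le_between.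
  unfold Rdiv. rewrite Rabs_mult, (Rabs_pos_eq (/ Cmod z))
    by (left; apply Rinv_0_lt_compat, Hz).
  apply Rmult_le_reg_r with (Cmod z); [exact Hz|].
  rewrite Rmult_assoc, Rinv_l by lra. rewrite Rmult_1_r, Rmult_1_l. apply re_le_Cmod.
Qed.

Lemma cos_Arg : forall z : C, 0 <= Im z -> z <> 0 -> cos (Arg z) = Re z / Cmod z.
Proof.
  intros z Hz Hn. rewrite Arg_upper by assumption.
  apply cos_acos, Re_div_Cmod_bounds, Hn.
Qed.

Lemma sin_Arg : forall z : C, 0 <= Im z -> z <> 0 -> sin (Arg z) = Im z / Cmod z.
Proof.
  intros z Hz Hn. rewrite Arg_upper by assumption.
  rewrite sin_acos by (apply Re_div_Cmod_bounds, Hn).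
  apply Cmod_gt_0 in Hn.
  assert (Hq : 0 <= Im z / Cmod z).
  { apply Rmult_le_pos; [assumption | left; apply Rinv_0_lt_compat, Hn]. }
  rewrite <- (sqrt_Rsqr (Im z / Cmod z)) by assumption.
  f_equal. unfold Rsqr.
  assert (H2 := Cmod2_alt z).
  apply Rmult_eq_reg_r with (Cmod z ^ 2); [|apply pow_nonzero; lra].
  field_simplify; [|lra|lra]. rewrite H2. ring.
Qed.

Lemma Arg_unique :
  forall (z : C) (r theta : R), 0 < r -> 0 <= theta <= PI ->
    Re z = r * cos theta -> Im z = r * sin theta -> Arg z = theta.
Proof.
  intros z r th Hr Hth H1 H2.
  assert (Hs := sin_ge_0 th (proj1 Hth) (proj2 Hth)).
  assert (Hi : 0 <= Im z) by (rewrite H2; apply Rmult_le_pos; lra).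
  assert (Hm : Cmod z = r).
  { apply Rsqr_inj; [apply Cmod_ge_0 | lra |]. unfold Rsqr.
    assert (H3 := Cmod2_alt z). rewrite H1, H2 in H3.
    assert (H4 := sin2_cos2 th). unfold Rsqr in H4.
    replace (Cmod z * Cmod z) with (Cmod z ^ 2) by ring. rewrite H3.
    replace (r * r) with (r * r * 1) by ring. rewrite <- H4. ring. }
  rewrite Arg_upper, Hm, H1 by assumption.
  replace (r * cos th / r) with (cos th) by (field; lra).
  apply acos_cos, Hth.
Qed.

Lemma Arg_pos_real : forall r : R, 0 < r -> Arg (RtoC r) = 0.
Proof.
  intros r Hr. apply Arg_unique with r; simpl; try lra.
  - generalize PI_RGT_0; lra.
  - rewrite cos_0; ring.
  - rewrite sin_0; ring.
Qed.

Lemma Arg_neg_real : forall r : R, r < 0 -> Arg (RtoC r) = PI.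
Proof.
  intros r Hr. apply Arg_unique with (- r); simpl; try lra.
  - generalize PI_RGT_0; lra.
  - rewrite cos_PI; ring.
  - rewrite sin_PI; ring.
Qed.

Lemma Arg_scale :
  forall (k : R) (z : C), 0 < k -> 0 <= Im z -> z <> 0 -> Arg (RtoC k * z)%C = Arg z.
Proof.
  intros k z Hk Hz Hn. assert (Hm := Hn). apply Cmod_gt_0 in Hm.
  apply Arg_unique with (k * Cmod z).
  - apply Rmult_lt_0_compat; assumption.
  - apply Arg_bounds, Hz.
  - rewrite cos_Arg by assumption. destruct z; simpl in *. field. lra.
  - rewrite sin_Arg by assumption. destruct z; simpl in *. field. lra.
Qed.

Lemma Im_pos_nonzero : forall z : C, 0 < Im z -> z <> 0.
Proof. intros z Hz H. rewrite H in Hz. simpl in Hz. lra. Qed.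

Lemma Arg_atan : forall u v : R, 0 < v -> Arg (u, v) = PI / 2 - atan (u / v).
Proof.
  intros u v Hv.
  assert (Hb := atan_bound (u / v)).
  assert (Hc : 0 < cos (atan (u / v))) by (apply cos_gt_0; lra).
  apply Arg_unique with (v / cos (atan (u / v))).
  - apply Rdiv_lt_0_compat; assumption.
  - lra.
  - assert (Ht := tan_atan (u / v)). unfold tan in Ht.
    rewrite cos_shift. simpl.
    replace (v / cos (atan (u / v)) * sin (atan (u / v)))
      with (v * (sin (atan (u / v)) / cos (atan (u / v)))) by (field; lra).
    rewrite Ht. field. lra.
  - rewrite sin_shift. simpl. field. lra.
Qed.

Lemma nonreal_neq : forall (z : C) (q : R), 0 < Im z -> z <> RtoC q.
Proof. intros z q Hz E. rewrite E in Hz. simpl in Hz. lra. Qed.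

Lemma minus_nonzero : forall z w : C, z <> w -> (z - w)%C <> 0.
Proof. intros z w H E. apply H. replace w with (w + 0)%C by ring. rewrite <- E. ring. Qed.

(** Two points of the upper half-plane whose distance is small compared with their
    moduli have close arguments, because
    [cos (Arg z - Arg w) >= 1 - |z - w|^2 / (2 |z| |w|)]. *)
Lemma Arg_close :
  forall eps : R, 0 < eps -> exists delta : R, 0 < delta /\
    forall z w : C, 0 <= Im z -> 0 <= Im w -> z <> 0 -> w <> 0 ->
      Cmod (z - w)%C ^ 2 < delta * (Cmod z * Cmod w) ->
      Rabs (Arg z - Arg w) < eps.
Proof.
  intros eps He.
  assert (Hpi := PI_RGT_0).
  set (e := Rmin eps PI).
  assert (He0 : 0 < e <= PI)
    by (unfold e; split; [apply Rmin_glb_lt; lra | apply Rmin_r]).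
  assert (Hce : cos e < 1) by (rewrite <- cos_0; apply cos_decreasing_1; lra).
  exists (2 * (1 - cos e)). split; [lra|].
  intros z w Hz Hw Hz0 Hw0 H.
  destruct (Rlt_le_dec (Rabs (Arg z - Arg w)) eps) as [|Hge]; [assumption|exfalso].
  assert (Bz := Arg_bounds z Hz). assert (Bw := Arg_bounds w Hw).
  assert (Ha : e <= Rabs (Arg z - Arg w) <= PI).
  { split; [apply Rle_trans with eps; [apply Rmin_l | assumption]|].
    apply Rabs_le_between. lra. }
  assert (Hcos : cos (Rabs (Arg z - Arg w)) <= cos e)
    by (apply cos_decr_1; lra).
  assert (Hcos' : cos (Rabs (Arg z - Arg w)) = cos (Arg z - Arg w)).
  { unfold Rabs. destruct (Rcase_abs _); [apply cos_neg | reflexivity]. }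
  rewrite Hcos', cos_minus, !cos_Arg, !sin_Arg in Hcos by assumption.
  apply Cmod_gt_0 in Hz0. apply Cmod_gt_0 in Hw0.
  assert (E1 := Cmod2_alt z). assert (E2 := Cmod2_alt w).
  assert (E3 := Cmod2_alt (z - w)%C).
  assert (E4 : Cmod (z - w)%C ^ 2
               = Cmod z ^ 2 + Cmod w ^ 2 - 2 * (Re z * Re w + Im z * Im w)).
  { rewrite E3, E1, E2. destruct z, w; simpl. ring. }
  assert (Hp : 0 < Cmod z * Cmod w) by (apply Rmult_lt_0_compat; assumption).
  assert (Hin : Re z * Re w + Im z * Im w <= cos e * (Cmod z * Cmod w)).
  { replace (Re z * Re w + Im z * Im w)
      with ((Re z / Cmod z * (Re w / Cmod w) + Im z / Cmod z * (Im w / Cmod w))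
            * (Cmod z * Cmod w)) by (field; lra).
    apply Rmult_le_compat_r; lra. }
  generalize (pow2_ge_0 (Cmod z - Cmod w)). intros Hsq. nra.
Qed.

(** * Limits of moduli and arguments *)

Lemma lim_C :
  forall {T : Type} (F : (T -> Prop) -> Prop) {FF : Filter F} (g : T -> C) (c : C),
    filterlim g F (locally c) <->
    forall eps : R, 0 < eps -> F (fun t => Cmod (g t - c)%C < eps).
Proof.
  intros T F FF g c. split.
  - intros H eps He.
    assert (H2 : 0 < sqrt 2) by (apply sqrt_lt_R0; lra).
    assert (Hd : 0 < eps / sqrt 2) by (apply Rdiv_lt_0_compat; assumption).
    generalize (proj1 (filterlim_locally g c) H (mkposreal _ Hd)). apply filter_imp.
    intros t Ht. apply C_NormedModule_mixin_compat2 in Ht.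
    replace eps with (sqrt 2 * (eps / sqrt 2)) by (field; lra). exact Ht.
  - intros H. apply filterlim_locally. intros eps.
    generalize (H eps (cond_pos eps)). apply filter_imp.
    intros t Ht. apply C_NormedModule_mixin_compat1. exact Ht.
Qed.

Lemma lim_R :
  forall {T : Type} (F : (T -> Prop) -> Prop) {FF : Filter F} (g : T -> R) (c : R),
    filterlim g F (locally c) <->
    forall eps : R, 0 < eps -> F (fun t => Rabs (g t - c) < eps).
Proof.
  intros T F FF g c. split.
  - intros H eps He. exact (proj1 (filterlim_locally g c) H (mkposreal _ He)).
  - intros H. apply filterlim_locally. intros eps. exact (H eps (cond_pos eps)).
Qed.

Lemma Cmod_triangle_inv : forall z w : C, Rabs (Cmod z - Cmod w) <= Cmod (z - w)%C.
Proof.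
  intros z w. apply Rabs_le_between'.
  assert (H1 := Cmod_triangle (z - w)%C w). assert (H2 := Cmod_triangle (w - z)%C z).
  replace (z - w + w)%C with z in H1 by ring.
  replace (w - z + z)%C with w in H2 by ring.
  replace (w - z)%C with (- (z - w))%C in H2 by ring. rewrite Cmod_opp in H2. lra.
Qed.

Section Limits.

Context {T : Type} (F : (T -> Prop) -> Prop) {FF : Filter F}.

Lemma lim_plus :
  forall (f g : T -> R) (a b : R),
    filterlim f F (locally a) -> filterlim g F (locally b) ->
    filterlim (fun t => f t + g t) F (locally (a + b)).
Proof.
  intros f g a b Hf Hg.
  eapply filterlim_comp_2; [exact Hf | exact Hg |].
  exact (filterlim_plus (V := R_NormedModule) a b).
Qed.

Lemma lim_map :
  forall (phi : R -> R) (f : T -> R) (a : R),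
    continuous phi a -> filterlim f F (locally a) ->
    filterlim (fun t => phi (f t)) F (locally (phi a)).
Proof. intros phi f a Hp Hf. eapply filterlim_comp; [exact Hf | exact Hp]. Qed.

Lemma lim_mult :
  forall (f g : T -> R) (a b : R),
    filterlim f F (locally a) -> filterlim g F (locally b) ->
    filterlim (fun t => f t * g t) F (locally (a * b)).
Proof.
  intros f g a b Hf Hg. eapply filterlim_comp_2; [exact Hf | exact Hg |].
  exact (filterlim_mult (K := R_AbsRing) a b).
Qed.

Lemma lim_scal :
  forall (k : R) (f : T -> R) (a : R), filterlim f F (locally a) ->
    filterlim (fun t => k * f t) F (locally (k * a)).
Proof.
  intros k f a Hf. apply (lim_map (fun u => k * u)); [|exact Hf].
  apply (continuous_mult (fun _ => k) (fun u => u));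
    [apply continuous_const | apply continuous_id].
Qed.

Lemma lim_combine :
  forall (m n : R) (f g : T -> R) (a b : R),
    filterlim f F (locally a) -> filterlim g F (locally b) ->
    filterlim (fun t => m * f t + n * g t) F (locally (m * a + n * b)).
Proof. intros m n f g a b Hf Hg. apply lim_plus; apply lim_scal; assumption. Qed.

Lemma lim_Re : forall (g : T -> C) (c : C), filterlim g F (locally c) ->
  filterlim (fun t => Re (g t)) F (locally (Re c)).
Proof.
  intros g c H. apply (lim_R F). intros eps He.
  generalize (proj1 (lim_C F g c) H eps He). apply filter_imp. intros t Ht.
  eapply Rle_lt_trans; [|exact Ht]. exact (re_le_Cmod (g t - c)%C).
Qed.

Lemma lim_Im : forall (g : T -> C) (c : C), filterlim g F (locally c) ->
  filterlim (fun t => Im (g t)) F (locally (Im c)).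
Proof.
  intros g c H. apply (lim_R F). intros eps He.
  generalize (proj1 (lim_C F g c) H eps He). apply filter_imp. intros t Ht.
  eapply Rle_lt_trans; [|exact Ht].
  eapply Rle_trans; [|apply (Rmax_Cmod (g t - c)%C)]. eapply Rle_trans; [|apply Rmax_r].
  apply Req_le. reflexivity.
Qed.

Lemma lim_Cmod : forall (g : T -> C) (c : C), filterlim g F (locally c) ->
  filterlim (fun t => Cmod (g t)) F (locally (Cmod c)).
Proof.
  intros g c H. apply (lim_R F). intros eps He.
  generalize (proj1 (lim_C F g c) H eps He). apply filter_imp. intros t Ht.
  eapply Rle_lt_trans; [apply Cmod_triangle_inv | exact Ht].
Qed.

Lemma lim_Cminus : forall (g : T -> C) (c q : C), filterlim g F (locally c) ->
  filterlim (fun t => (g t - q)%C) F (locally (c - q)%C).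
Proof.
  intros g c q H. apply (lim_C F). intros eps He.
  generalize (proj1 (lim_C F g c) H eps He). apply filter_imp. intros t Ht.
  replace (g t - q - (c - q))%C with (g t - c)%C by ring. exact Ht.
Qed.

Lemma lim_ln_Cmod : forall (g : T -> C) (c : C), c <> 0 -> filterlim g F (locally c) ->
  filterlim (fun t => ln (Cmod (g t))) F (locally (ln (Cmod c))).
Proof.
  intros g c Hc H. apply lim_map; [|apply lim_Cmod, H].
  apply (ex_derive_continuous ln). eexists. apply is_derive_ln, Cmod_gt_0, Hc.
Qed.

Lemma lim_Arg : forall (g : T -> C) (c : C), c <> 0 -> 0 <= Im c ->
  F (fun t => 0 <= Im (g t)) -> filterlim g F (locally c) ->
  filterlim (fun t => Arg (g t)) F (locally (Arg c)).
Proof.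
  intros g c Hc Hic Hig H. apply (lim_R F). intros eps He.
  destruct (Arg_close eps He) as [d [Hd Hcl]].
  assert (Hm := proj1 (Cmod_gt_0 c) Hc).
  set (k := Rmin (1 / 2) (d / 2)).
  assert (Hk : 0 < k) by (apply Rmin_glb_lt; lra).
  assert (Hk1 : k <= 1 / 2) by apply Rmin_l.
  assert (Hk2 : k <= d / 2) by apply Rmin_r.
  assert (Hkm : 0 < k * Cmod c) by (apply Rmult_lt_0_compat; assumption).
  generalize (filter_and _ _ Hig (proj1 (lim_C F g c) H _ Hkm)).
  apply filter_imp. intros t [Hi Ht].
  assert (Ht' := Cmod_triangle_inv (g t) c).
  assert (Hlow : 1 / 2 * Cmod c < Cmod (g t)).
  { apply Rle_lt_trans with (Cmod c - k * Cmod c); [nra|].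
    unfold Rabs in Ht'; destruct (Rcase_abs _) in Ht'; lra. }
  apply Hcl; try assumption.
  - intros E. rewrite E, Cmod_0 in Hlow. lra.
  - assert (H0 := Cmod_ge_0 (g t - c)%C).
    apply Rlt_le_trans with ((k * Cmod c) * (k * Cmod c)).
    + simpl. rewrite Rmult_1_r. apply Rmult_le_0_lt_compat; lra.
    + apply Rle_trans with ((1 / 2 * Cmod c) * (d / 2 * Cmod c)).
      * apply Rmult_le_compat; try lra; apply Rmult_le_compat_r; lra.
      * assert (Hp : d * (1 / 2 * Cmod c * Cmod c) <= d * (Cmod (g t) * Cmod c))
          by (apply Rmult_le_compat_l; [lra | apply Rmult_le_compat_r; lra]).
        assert (Hq : 0 < d * (Cmod c * Cmod c))
          by (apply Rmult_lt_0_compat; [lra | apply Rmult_lt_0_compat; lra]).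
        lra.
Qed.

Lemma lim_closed_half_plane {PF : ProperFilter' F} : forall (g : T -> C) (c : C),
  F (fun t => 0 <= Im (g t)) -> filterlim g F (locally c) -> 0 <= Im c.
Proof.
  intros g c Hg H. destruct (Rle_lt_dec 0 (Im c)) as [|Hn]; [assumption|exfalso].
  assert (Hp : 0 < - Im c) by lra.
  assert (HFalse : F (fun _ => False)).
  { assert (Him := proj1 (lim_R F (fun t => Im (g t)) (Im c)) (lim_Im g c H) _ Hp).
    generalize (filter_and _ _ Hg Him).
    apply filter_imp. intros t [H1 H2]. apply Rabs_lt_between in H2. lra. }
  destruct PF as [Hne _]. exact (Hne HFalse).
Qed.

Lemma lim_nonzero_of_ln {PF : ProperFilter' F} : forall (g : T -> C) (c : C) (l : R),
  F (fun t => g t <> 0) -> filterlim g F (locally c) ->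
  filterlim (fun t => ln (Cmod (g t))) F (locally l) -> c <> 0.
Proof.
  intros g c l Hn Hg Hl Hc.
  assert (H : filterlim (fun t => Cmod (g t)) F (locally (exp l))).
  { apply filterlim_ext_loc with (fun t => exp (ln (Cmod (g t)))).
    - generalize Hn. apply filter_imp. intros t Ht. apply exp_ln, Cmod_gt_0, Ht.
    - apply lim_map with (2 := Hl).
      apply (ex_derive_continuous exp). eexists. apply is_derive_exp. }
  assert (E := filterlim_locally_unique _ _ _ H (lim_Cmod g c Hg)).
  rewrite Hc, Cmod_0 in E. generalize (exp_pos l). lra.
Qed.

End Limits.

Lemma lim_pair : forall {T : Type} (F : (T -> Prop) -> Prop) {FF : Filter F}
    (P Q : T -> R) (a b : R),
  filterlim P F (locally a) -> filterlim Q F (locally b) ->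
  filterlim (fun t => (P t, Q t) : C) F (locally ((a, b) : C)).
Proof.
  intros T F FF P Q a b HP HQ. apply (filterlim_locally (U := C_UniformSpace)). intros eps.
  generalize (filter_and _ _ (proj1 (filterlim_locally P a) HP eps)
                             (proj1 (filterlim_locally Q b) HQ eps)).
  apply filter_imp. intros t [H1 H2]. split; assumption.
Qed.

Lemma lim_boundary : forall u : R,
  filterlim (fun y : R => (u, y) : C) (at_right 0) (locally (RtoC u)).
Proof.
  intros u. apply (lim_pair (at_right 0) (fun _ => u) (fun y => y) u 0).
  - apply filterlim_const.
  - intros P HP. apply filter_le_within. exact HP.
Qed.

Lemma at_right_pos : at_right 0 (fun y => 0 < y).
Proof. unfold at_right, within. apply filter_forall. auto. Qed.

Lemma lim_boundary_ln : forall u : R, u <> 0 ->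
  filterlim (fun y : R => ln (Cmod (u, y))) (at_right 0) (locally (ln (Rabs u))).
Proof.
  intros u Hu. rewrite <- Cmod_R.
  apply (lim_ln_Cmod (at_right 0) (fun y : R => (u, y))); [|apply lim_boundary].
  intros E. apply Hu, (f_equal Re E).
Qed.

Lemma lim_boundary_Arg : forall u : R, u <> 0 ->
  filterlim (fun y : R => Arg (u, y)) (at_right 0) (locally (Arg (RtoC u))).
Proof.
  intros u Hu. apply (lim_Arg (at_right 0) (fun y : R => (u, y))).
  - intros E. apply Hu, (f_equal Re E).
  - simpl. lra.
  - generalize at_right_pos. apply filter_imp. simpl. intros; lra.
  - apply lim_boundary.
Qed.

(** * Real and imaginary parts of a logarithm along a curve *)

Lemma ln_Cmod : forall u v : R, 0 < u ^ 2 + v ^ 2 ->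
  ln (Cmod (u, v)) = / 2 * ln (u ^ 2 + v ^ 2).
Proof.
  intros u v H. unfold Cmod; simpl fst; simpl snd.
  assert (Hs := sqrt_lt_R0 _ H). rewrite <- (sqrt_sqrt (u ^ 2 + v ^ 2)) at 2 by lra.
  rewrite ln_mult by assumption. field.
Qed.

Lemma sum_sq_pos : forall u v : R, 0 < v -> 0 < u ^ 2 + v ^ 2.
Proof. intros u v Hv. nra. Qed.

Section LogCurve.

Variables (P Q : R -> R) (s P' Q' : R).
Hypotheses (HP : is_derive P s P') (HQ : is_derive Q s Q') (HQ0 : 0 < Q s).

Let DP : Derive (fun u : R => P u) s = P'.
Proof. exact (is_derive_unique P s P' HP). Qed.

Let DQ : Derive (fun u : R => Q u) s = Q'.
Proof. exact (is_derive_unique Q s Q' HQ). Qed.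

Let Qpos : locally s (fun u => 0 < Q u).
Proof.
  assert (Hc : continuous Q s) by (apply (ex_derive_continuous Q); eexists; exact HQ).
  apply Hc. apply open_gt. exact HQ0.
Qed.

Lemma is_derive_ln_Cmod :
  is_derive (fun u => ln (Cmod (P u, Q u))) s
    ((P s * P' + Q s * Q') / (P s ^ 2 + Q s ^ 2)).
Proof.
  assert (H0 := sum_sq_pos (P s) (Q s) HQ0).
  apply is_derive_ext_loc with (fun u => / 2 * ln (P u ^ 2 + Q u ^ 2)).
  - generalize Qpos. apply filter_imp. intros u Hu.
    symmetry. apply ln_Cmod, sum_sq_pos, Hu.
  - auto_derive.
    + repeat split; try (eexists; eassumption). simpl in H0. lra.
    + rewrite DP, DQ.
      field. simpl in H0. simpl. lra.
Qed.

Lemma is_derive_Arg :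
  is_derive (fun u => Arg (P u, Q u)) s
    ((P s * Q' - Q s * P') / (P s ^ 2 + Q s ^ 2)).
Proof.
  assert (H0 := sum_sq_pos (P s) (Q s) HQ0).
  apply is_derive_ext_loc with (fun u => PI / 2 - atan (P u / Q u)).
  - generalize Qpos. apply filter_imp. intros u Hu. symmetry. apply Arg_atan, Hu.
  - auto_derive.
    + repeat split; try (eexists; eassumption). lra.
    + rewrite DP, DQ.
      unfold Rsqr. field. split; lra.
Qed.

End LogCurve.

Section LogCurveContinuity.

Variables (P Q : R -> R) (s : R).
Hypotheses (HP : continuous P s) (HQ : continuous Q s) (HQ0 : 0 < Q s).

Let Qpos : locally s (fun u => 0 <= Q u).
Proof.
  assert (H : locally s (fun u => 0 < Q u)) by (apply HQ, open_gt, HQ0).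
  generalize H. apply filter_imp. intros; lra.
Qed.

Lemma continuous_ln_Cmod : continuous (fun u => ln (Cmod (P u, Q u))) s.
Proof.
  apply (lim_ln_Cmod (locally s) (fun u => (P u, Q u)) (P s, Q s)).
  - apply Im_pos_nonzero, HQ0.
  - apply (lim_pair (locally s)); assumption.
Qed.

Lemma continuous_Arg : continuous (fun u => Arg (P u, Q u)) s.
Proof.
  apply (lim_Arg (locally s) (fun u => (P u, Q u)) (P s, Q s)).
  - apply Im_pos_nonzero, HQ0.
  - simpl. lra.
  - exact Qpos.
  - apply (lim_pair (locally s)); assumption.
Qed.

End LogCurveContinuity.

(** * Conserved quantities of the flow *)

(** [X = x - W] is the distance from the driving point to the force point, and
    [U + i V = g(z) - W] the position of a point [z] relative to the driving point.
    With [a = rho + 2] they solve, on [(0, t)],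
    [X' = a / X] and [Z' = 2 / Z + (a - 2) / X], where [Z = U + i V].
    Beyond the end points [0] and [t] the functions are arbitrary continuous extensions,
    with [X] and [V] positive; this avoids one-sided limits. *)
Record flow (a t : R) (X U V : R -> R) : Prop := {
  flow_time : 0 <= t;
  flow_X_cont : forall s, continuous X s;
  flow_U_cont : forall s, continuous U s;
  flow_V_cont : forall s, continuous V s;
  flow_X_pos : forall s, 0 < X s;
  flow_V_pos : forall s, 0 < V s;
  flow_X : forall s, 0 < s < t -> is_derive X s (a / X s);
  flow_U : forall s, 0 < s < t ->
    is_derive U s (2 * U s / (U s ^ 2 + V s ^ 2) + (a - 2) / X s);
  flow_V : forall s, 0 < s < t -> is_derive V s (- (2 * V s / (U s ^ 2 + V s ^ 2)))
}.

Section Conserved.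

Variables (a t : R) (X U V : R -> R).
Hypothesis HF : flow a t X U V.

Lemma continuous_U_plus : forall k s, continuous (fun s => U s + k * X s) s.
Proof.
  intros k s. apply (continuous_plus U (fun s => k * X s)); [apply HF|].
  apply (continuous_mult (fun _ => k) X); [apply continuous_const | apply HF].
Qed.

Lemma is_derive_U_plus : forall k s, 0 < s < t ->
  is_derive (fun s => U s + k * X s) s
    (2 * U s / (U s ^ 2 + V s ^ 2) + (a - 2) / X s + k * (a / X s)).
Proof.
  intros k s Hs. apply (is_derive_plus U (fun s => k * X s)).
  - apply (flow_U _ _ _ _ _ HF s Hs).
  - apply (is_derive_scal X s k). apply (flow_X _ _ _ _ _ HF s Hs).
Qed.

Lemma continuous_ln_shift : forall k s,
  continuous (fun s => ln (Cmod (U s + k * X s, V s))) s.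
Proof.
  intros k s. apply (continuous_ln_Cmod (fun s => U s + k * X s) V);
    [apply continuous_U_plus | exact (flow_V_cont _ _ _ _ _ HF s)
    | exact (flow_V_pos _ _ _ _ _ HF s)].
Qed.

Lemma continuous_Arg_shift : forall k s,
  continuous (fun s => Arg (U s + k * X s, V s)) s.
Proof.
  intros k s. apply (continuous_Arg (fun s => U s + k * X s) V);
    [apply continuous_U_plus | exact (flow_V_cont _ _ _ _ _ HF s)
    | exact (flow_V_pos _ _ _ _ _ HF s)].
Qed.

Lemma is_derive_ln_shift : forall k s, 0 < s < t ->
  is_derive (fun s => ln (Cmod (U s + k * X s, V s))) s
    (((U s + k * X s) * (2 * U s / (U s ^ 2 + V s ^ 2) + (a - 2) / X s + k * (a / X s))
      + V s * - (2 * V s / (U s ^ 2 + V s ^ 2))) / ((U s + k * X s) ^ 2 + V s ^ 2)).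
Proof.
  intros k s Hs.
  exact (is_derive_ln_Cmod (fun s => U s + k * X s) V s _ _ (is_derive_U_plus k s Hs)
           (flow_V _ _ _ _ _ HF s Hs) (flow_V_pos _ _ _ _ _ HF s)).
Qed.

Lemma is_derive_Arg_shift : forall k s, 0 < s < t ->
  is_derive (fun s => Arg (U s + k * X s, V s)) s
    (((U s + k * X s) * - (2 * V s / (U s ^ 2 + V s ^ 2))
      - V s * (2 * U s / (U s ^ 2 + V s ^ 2) + (a - 2) / X s + k * (a / X s)))
     / ((U s + k * X s) ^ 2 + V s ^ 2)).
Proof.
  intros k s Hs.
  exact (is_derive_Arg (fun s => U s + k * X s) V s _ _ (is_derive_U_plus k s Hs)
           (flow_V _ _ _ _ _ HF s Hs) (flow_V_pos _ _ _ _ _ HF s)).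
Qed.

(** The functions [Z + k X] with [k = -1] and [k = 2 / a] solve linear equations:
    [(Z - X)' = - 2 (Z - X) / (X Z)] and
    [(Z + 2 X / a)' = a (Z + 2 X / a) / (X Z)].  Hence
    [a log (Z - X) + 2 log (Z + 2 X / a)] is conserved; this is its real part. *)
Lemma conserved_ln : a <> 0 ->
  a * ln (Cmod (U t + -1 * X t, V t)) + 2 * ln (Cmod (U t + 2 / a * X t, V t)) =
  a * ln (Cmod (U 0 + -1 * X 0, V 0)) + 2 * ln (Cmod (U 0 + 2 / a * X 0, V 0)).
Proof.
  intros Ha.
  apply (constant_of_zero_derivative
    (fun s => a * ln (Cmod (U s + -1 * X s, V s)) + 2 * ln (Cmod (U s + 2 / a * X s, V s)))).
  - apply HF.
  - intros s _.
    apply (continuous_plus (fun s => a * ln (Cmod (U s + -1 * X s, V s)))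
             (fun s => 2 * ln (Cmod (U s + 2 / a * X s, V s))));
      apply continuous_scal_fun, continuous_ln_shift.
  - intros s Hs. evar_last.
    + apply (is_derive_plus (fun s => a * ln (Cmod (U s + -1 * X s, V s)))
               (fun s => 2 * ln (Cmod (U s + 2 / a * X s, V s)))).
      * apply is_derive_scal.
        exact (is_derive_ln_shift (-1) s Hs).
      * apply is_derive_scal.
        exact (is_derive_ln_shift (2 / a) s Hs).
    + assert (HX := flow_X_pos _ _ _ _ _ HF s).
      assert (HV := flow_V_pos _ _ _ _ _ HF s).
      assert (H1 := sum_sq_pos (U s) (V s) HV).
      assert (H2 := sum_sq_pos (U s + -1 * X s) (V s) HV).
      assert (H3 := sum_sq_pos (U s * a + 2 * X s) (V s) HV).
      assert (H4 := Rlt_0_sqr a Ha). assert (H5 := Rlt_0_sqr (V s)).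
      unfold plus; unfold Rsqr in *; simpl in *. field.
      repeat split; try lra.
      generalize (Rle_0_sqr (U s * a + 2 * X s)).
      assert (0 < V s * V s * (a * a)) by (apply Rmult_lt_0_compat; nra).
      unfold Rsqr. lra.
Qed.

(** The imaginary part of the conservation law of [conserved_ln]. *)
Lemma conserved_Arg : a <> 0 ->
  a * Arg (U t + -1 * X t, V t) + 2 * Arg (U t + 2 / a * X t, V t) =
  a * Arg (U 0 + -1 * X 0, V 0) + 2 * Arg (U 0 + 2 / a * X 0, V 0).
Proof.
  intros Ha.
  apply (constant_of_zero_derivative
    (fun s => a * Arg (U s + -1 * X s, V s) + 2 * Arg (U s + 2 / a * X s, V s))).
  - apply HF.
  - intros s _.
    apply (continuous_plus (fun s => a * Arg (U s + -1 * X s, V s))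
             (fun s => 2 * Arg (U s + 2 / a * X s, V s)));
      apply continuous_scal_fun, continuous_Arg_shift.
  - intros s Hs. evar_last.
    + apply (is_derive_plus (fun s => a * Arg (U s + -1 * X s, V s))
               (fun s => 2 * Arg (U s + 2 / a * X s, V s))).
      * apply is_derive_scal.
        exact (is_derive_Arg_shift (-1) s Hs).
      * apply is_derive_scal.
        exact (is_derive_Arg_shift (2 / a) s Hs).
    + assert (HX := flow_X_pos _ _ _ _ _ HF s).
      assert (HV := flow_V_pos _ _ _ _ _ HF s).
      assert (H1 := sum_sq_pos (U s) (V s) HV).
      assert (H2 := sum_sq_pos (U s + -1 * X s) (V s) HV).
      assert (H3 := sum_sq_pos (U s * a + 2 * X s) (V s) HV).
      assert (H4 := Rlt_0_sqr a Ha). assert (H5 := Rlt_0_sqr (V s)).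
      unfold plus; unfold Rsqr in *; simpl in *. field.
      repeat split; try lra.
      generalize (Rle_0_sqr (U s * a + 2 * X s)).
      assert (0 < V s * V s * (a * a)) by (apply Rmult_lt_0_compat; nra).
      unfold Rsqr. lra.
Qed.

Lemma flow_X_const : a = 0 -> forall s, 0 <= s <= t -> X s = X 0.
Proof.
  intros Ha s Hs. apply constant_of_zero_derivative; [apply Hs | intros; apply HF |].
  intros u Hu. evar_last; [apply HF; lra|]. rewrite Ha. unfold Rdiv. ring.
Qed.

(** For [a = 0] the function [X] is constant and the conserved quantity at time [s] is
    [(Z - X) + X log (Z - X) + 2 s / X]; this is its real part. *)
Lemma conserved_a0_re : a = 0 ->
  (U t + -1 * X t) + X 0 * ln (Cmod (U t + -1 * X t, V t)) + 2 / X 0 * t =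
  (U 0 + -1 * X 0) + X 0 * ln (Cmod (U 0 + -1 * X 0, V 0)).
Proof.
  intros Ha.
  transitivity ((U 0 + -1 * X 0) + X 0 * ln (Cmod (U 0 + -1 * X 0, V 0)) + 2 / X 0 * 0);
    [|ring].
  apply (constant_of_zero_derivative
    (fun s => (U s + -1 * X s) + X 0 * ln (Cmod (U s + -1 * X s, V s)) + 2 / X 0 * s)).
  - apply HF.
  - intros s _.
    apply (continuous_plus
             (fun s => (U s + -1 * X s) + X 0 * ln (Cmod (U s + -1 * X s, V s)))
             (fun s => 2 / X 0 * s)).
    + apply (continuous_plus (fun s => U s + -1 * X s)); [apply continuous_U_plus|].
      apply continuous_scal_fun, continuous_ln_shift.
    + apply continuous_scal_fun, continuous_id.
  - intros s Hs. evar_last.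
    + apply (is_derive_plus
               (fun s => (U s + -1 * X s) + X 0 * ln (Cmod (U s + -1 * X s, V s)))
               (fun s => 2 / X 0 * s)).
      * apply (is_derive_plus (fun s => U s + -1 * X s)); [apply is_derive_U_plus, Hs|].
        apply is_derive_scal.
        exact (is_derive_ln_shift (-1) s Hs).
      * apply is_derive_scal, (is_derive_id (K := R_AbsRing)).
    + assert (HX := flow_X_pos _ _ _ _ _ HF 0).
      assert (HV := flow_V_pos _ _ _ _ _ HF s).
      rewrite (flow_X_const Ha s) by lra.
      assert (H1 := sum_sq_pos (U s) (V s) HV).
      assert (H2 := sum_sq_pos (U s + -1 * X 0) (V s) HV).
      unfold plus, one; simpl in *. rewrite Ha. field. repeat split; lra.
Qed.

Lemma conserved_a0_im : a = 0 ->
  V t + X 0 * Arg (U t + -1 * X t, V t) = V 0 + X 0 * Arg (U 0 + -1 * X 0, V 0).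
Proof.
  intros Ha.
  apply (constant_of_zero_derivative
    (fun s => V s + X 0 * Arg (U s + -1 * X s, V s))).
  - apply HF.
  - intros s _. apply (continuous_plus V); [exact (flow_V_cont _ _ _ _ _ HF s)|].
    apply continuous_scal_fun, continuous_Arg_shift.
  - intros s Hs. evar_last.
    + apply (is_derive_plus V (fun s => X 0 * Arg (U s + -1 * X s, V s))).
      * exact (flow_V _ _ _ _ _ HF s Hs).
      * apply is_derive_scal.
        exact (is_derive_Arg_shift (-1) s Hs).
    + assert (HX := flow_X_pos _ _ _ _ _ HF 0).
      assert (HV := flow_V_pos _ _ _ _ _ HF s).
      rewrite (flow_X_const Ha s) by lra.
      assert (H1 := sum_sq_pos (U s) (V s) HV).
      assert (H2 := sum_sq_pos (U s + -1 * X 0) (V s) HV).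
      unfold plus; simpl in *. rewrite Ha. field. repeat split; lra.
Qed.

Lemma continuous_inv_modulus : forall f s, continuous f s ->
  continuous (fun s => X s * (f s / ((U s + -1 * X s) ^ 2 + V s ^ 2))) s.
Proof.
  intros f s Hf.
  apply (continuous_mult X (fun s => f s / ((U s + -1 * X s) ^ 2 + V s ^ 2)));
    [apply HF|].
  apply (continuous_mult f (fun s => / ((U s + -1 * X s) ^ 2 + V s ^ 2))); [exact Hf|].
  assert (H2 := sum_sq_pos (U s + -1 * X s) (V s) (flow_V_pos _ _ _ _ _ HF s)).
  apply (continuous_comp (fun s => (U s + -1 * X s) ^ 2 + V s ^ 2) Rinv).
  - apply (continuous_plus (fun s => (U s + -1 * X s) ^ 2) (fun s => V s ^ 2)).
    + apply (continuous_comp (fun s => U s + -1 * X s) (fun u => u ^ 2));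
        [apply continuous_U_plus|].
      apply (ex_derive_continuous (fun u => u ^ 2)). auto_derive. exact I.
    + apply (continuous_comp V (fun u => u ^ 2)); [apply HF|].
      apply (ex_derive_continuous (fun u => u ^ 2)). auto_derive. exact I.
  - apply (ex_derive_continuous Rinv). auto_derive. lra.
Qed.

(** For [a = -2] the functions [Z - X] and [Z + 2 X / a] coincide, and [conserved_ln] is
    void.  Here [log (Z - X) - X / (Z - X)] is conserved; this is its real part. *)
Lemma conserved_am2_re : a = -2 ->
  ln (Cmod (U t + -1 * X t, V t))
    + -1 * (X t * ((U t + -1 * X t) / ((U t + -1 * X t) ^ 2 + V t ^ 2))) =
  ln (Cmod (U 0 + -1 * X 0, V 0))
    + -1 * (X 0 * ((U 0 + -1 * X 0) / ((U 0 + -1 * X 0) ^ 2 + V 0 ^ 2))).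
Proof.
  intros Ha.
  apply (constant_of_zero_derivative
    (fun s => ln (Cmod (U s + -1 * X s, V s))
      + -1 * (X s * ((U s + -1 * X s) / ((U s + -1 * X s) ^ 2 + V s ^ 2))))).
  - apply HF.
  - intros s _. apply (continuous_plus (fun s => ln (Cmod (U s + -1 * X s, V s)))).
    + apply continuous_ln_shift.
    + apply continuous_scal_fun, continuous_inv_modulus, continuous_U_plus.
  - intros s Hs.
    assert (HX := flow_X_pos _ _ _ _ _ HF s).
    assert (HV := flow_V_pos _ _ _ _ _ HF s).
    assert (H1 := sum_sq_pos (U s) (V s) HV).
    assert (H2 := sum_sq_pos (U s + -1 * X s) (V s) HV).
    assert (DX := flow_X _ _ _ _ _ HF s Hs).
    assert (DU := is_derive_U_plus (-1) s Hs).
    assert (DV := flow_V _ _ _ _ _ HF s Hs).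
    evar_last.
    + apply (is_derive_plus (fun s => ln (Cmod (U s + -1 * X s, V s)))
        (fun s => -1 * (X s * ((U s + -1 * X s) / ((U s + -1 * X s) ^ 2 + V s ^ 2))))).
      * exact (is_derive_ln_shift (-1) s Hs).
      * apply is_derive_scal.
        apply (is_derive_mult X (fun s => (U s + -1 * X s) / ((U s + -1 * X s) ^ 2 + V s ^ 2)));
          [exact DX | | intros; apply Rmult_comm].
        apply (is_derive_div (fun s => U s + -1 * X s)
                             (fun s => (U s + -1 * X s) ^ 2 + V s ^ 2)); [exact DU | | lra].
        apply (is_derive_plus (fun s => (U s + -1 * X s) ^ 2) (fun s => V s ^ 2)).
        -- apply (is_derive_pow (fun s => U s + -1 * X s)), DU.
        -- apply (is_derive_pow V), DV.
    + unfold plus, mult; simpl in *. rewrite Ha. field. repeat split; lra.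
Qed.

Lemma conserved_am2_im : a = -2 ->
  Arg (U t + -1 * X t, V t)
    + X t * (V t / ((U t + -1 * X t) ^ 2 + V t ^ 2)) =
  Arg (U 0 + -1 * X 0, V 0)
    + X 0 * (V 0 / ((U 0 + -1 * X 0) ^ 2 + V 0 ^ 2)).
Proof.
  intros Ha.
  apply (constant_of_zero_derivative
    (fun s => Arg (U s + -1 * X s, V s)
      + X s * (V s / ((U s + -1 * X s) ^ 2 + V s ^ 2)))).
  - apply HF.
  - intros s _. apply (continuous_plus (fun s => Arg (U s + -1 * X s, V s))).
    + apply continuous_Arg_shift.
    + apply continuous_inv_modulus, HF.
  - intros s Hs.
    assert (HX := flow_X_pos _ _ _ _ _ HF s).
    assert (HV := flow_V_pos _ _ _ _ _ HF s).
    assert (H1 := sum_sq_pos (U s) (V s) HV).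
    assert (H2 := sum_sq_pos (U s + -1 * X s) (V s) HV).
    assert (DX := flow_X _ _ _ _ _ HF s Hs).
    assert (DU := is_derive_U_plus (-1) s Hs).
    assert (DV := flow_V _ _ _ _ _ HF s Hs).
    evar_last.
    + apply (is_derive_plus (fun s => Arg (U s + -1 * X s, V s))
        (fun s => X s * (V s / ((U s + -1 * X s) ^ 2 + V s ^ 2)))).
      * exact (is_derive_Arg_shift (-1) s Hs).
      * apply (is_derive_mult X (fun s => V s / ((U s + -1 * X s) ^ 2 + V s ^ 2)));
          [exact DX | | intros; apply Rmult_comm].
        apply (is_derive_div V (fun s => (U s + -1 * X s) ^ 2 + V s ^ 2));
          [exact DV | | lra].
        apply (is_derive_plus (fun s => (U s + -1 * X s) ^ 2) (fun s => V s ^ 2)).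
        -- apply (is_derive_pow (fun s => U s + -1 * X s)), DU.
        -- apply (is_derive_pow V), DV.
    + unfold plus, mult; simpl in *. rewrite Ha. field. repeat split; lra.
Qed.

End Conserved.

(** * Limits that avoid the singular points *)

(** If [m ln |f - q| + n ln |f - q'|] converges, with [m <> 0] and [q <> q'], then [f]
    cannot converge to [q], where only the first term would be unbounded. *)
Lemma ln_balance_nondegenerate :
  forall {T : Type} (F : (T -> Prop) -> Prop) {PF : ProperFilter' F}
    (f : T -> C) (c q q' : C) (m n l : R) (r : T -> R),
    m <> 0 -> q <> q' ->
    F (fun t => f t <> q) ->
    F (fun t => m * ln (Cmod (f t - q)%C) + n * ln (Cmod (f t - q')%C) = r t) ->
    filterlim f F (locally c) -> filterlim r F (locally l) -> c <> q.
Proof.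
  intros T F PF f c q q' m n l r Hm Hq Hfq Heq Hf Hr Hc.
  assert (FF : Filter F) by apply PF.
  assert (Hcq' : (c - q')%C <> 0).
  { intros E. apply Hq. rewrite <- Hc. replace q' with (q' + 0)%C by ring.
    rewrite <- E. ring. }
  apply (lim_nonzero_of_ln F (fun t => (f t - q)%C) (c - q)%C
           (/ m * (l + - n * ln (Cmod (c - q')%C)))).
  - generalize Hfq. apply filter_imp. intros t Ht E. apply Ht.
    replace q with (q + 0)%C by ring. rewrite <- E. ring.
  - apply (lim_Cminus F), Hf.
  - apply filterlim_ext_loc with (fun t => / m * (r t + - n * ln (Cmod (f t - q')%C))).
    + generalize Heq. apply filter_imp. intros t Ht. rewrite <- Ht. field. exact Hm.
    + apply (lim_scal F), (lim_plus F); [exact Hr|]. apply (lim_scal F).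
      apply (lim_ln_Cmod F); [exact Hcq' | apply (lim_Cminus F), Hf].
  - rewrite Hc. ring.
Qed.

Lemma ln_le_pred : forall u : R, 0 < u -> ln u <= u - 1.
Proof.
  intros u Hu. assert (H := exp_ineq1_le (ln u)). rewrite exp_ln in H by exact Hu. lra.
Qed.

(** Here [r] and [theta] are the modulus and the argument of [z = u + i v].  If the real
    and the imaginary part of [log z - k / z] are bounded, then [z] stays away from [0],
    because [k^2 / |z|^2] is at most of order [(ln |z|)^2]. *)
Lemma log_minus_pole_nondegenerate :
  forall k M : R, 0 < k -> 0 <= M -> exists delta : R, 0 < delta /\
    forall r u v theta : R, 0 < r -> r ^ 2 = u ^ 2 + v ^ 2 -> 0 <= theta <= PI ->
      Rabs (ln r + -1 * (k * (u / r ^ 2))) <= M -> Rabs (theta + k * (v / r ^ 2)) <= M ->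
      delta <= r.
Proof.
  intros k M Hk HM. assert (Hpi := PI_RGT_0).
  set (K := 8 + 2 * M ^ 2 + (M + PI) ^ 2).
  assert (HK : 0 < K) by (unfold K; nra).
  exists (Rmin 1 (k ^ 2 / K)). split.
  - apply Rmin_glb_lt; [lra|]. apply Rdiv_lt_0_compat; [nra | exact HK].
  - intros r u v th Hr Hruv Hth H1 H2.
    destruct (Rlt_le_dec r 1) as [Hr1|Hr1];
      [|apply Rle_trans with 1; [apply Rmin_l | exact Hr1]].
    apply Rle_trans with (k ^ 2 / K); [apply Rmin_r|].
    set (K1 := ln r + -1 * (k * (u / r ^ 2))) in *.
    set (K2 := th + k * (v / r ^ 2)) in *.
    assert (E : k ^ 2 = r ^ 2 * ((ln r - K1) ^ 2 + (K2 - th) ^ 2)).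
    { unfold K1, K2. transitivity (k ^ 2 / r ^ 2 * (u ^ 2 + v ^ 2)).
      - rewrite <- Hruv. field. lra.
      - field. lra. }
    (* [r ^ 2 * ln r ^ 2 <= 4 * r], from [- ln s <= 1 / s] at [s = sqrt r] *)
    assert (Hln : r ^ 2 * ln r ^ 2 <= 4 * r).
    { set (s := sqrt r). assert (Hs : 0 < s) by (apply sqrt_lt_R0, Hr).
      assert (Es : r = s * s) by (symmetry; apply sqrt_sqrt; lra).
      assert (Hs1 : ln s < 0).
      { rewrite <- ln_1. apply ln_increasing; [exact Hs|]. nra. }
      assert (Hi : - ln s * s <= 1).
      { rewrite <- ln_Rinv by exact Hs.
        assert (H := ln_le_pred (/ s) (Rinv_0_lt_compat _ Hs)).
        apply Rmult_le_reg_r with (/ s); [apply Rinv_0_lt_compat, Hs|].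
        rewrite Rmult_assoc, Rinv_r by lra. lra. }
      rewrite Es, ln_mult by exact Hs.
      replace ((s * s) ^ 2 * (ln s + ln s) ^ 2) with (4 * (s * s) * (- ln s * s) ^ 2) by ring.
      assert (0 <= - ln s * s) by (apply Rmult_le_pos; lra).
      assert ((- ln s * s) ^ 2 <= 1) by nra. nra. }
    apply Rabs_le_between in H1. apply Rabs_le_between in H2.
    assert (B1 : (ln r - K1) ^ 2 <= 2 * ln r ^ 2 + 2 * M ^ 2).
    { generalize (pow2_ge_0 (ln r + K1)). assert (K1 ^ 2 <= M ^ 2) by nra. nra. }
    assert (B2 : (K2 - th) ^ 2 <= (M + PI) ^ 2) by nra.
    assert (Hr2 : 0 < r ^ 2) by nra. assert (Hr3 : r ^ 2 <= r) by nra.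
    assert (B : k ^ 2 <= K * r).
    { rewrite E. apply Rle_trans with (r ^ 2 * (2 * ln r ^ 2 + 2 * M ^ 2 + (M + PI) ^ 2)).
      - apply Rmult_le_compat_l; lra.
      - unfold K. assert (r ^ 2 * (2 * M ^ 2 + (M + PI) ^ 2) <= r * (2 * M ^ 2 + (M + PI) ^ 2))
          by (apply Rmult_le_compat_r; [nra | exact Hr3]). nra. }
    apply Rmult_le_reg_r with K; [exact HK|]. unfold Rdiv.
    rewrite Rmult_assoc, Rinv_l by lra. lra.
Qed.

(** * The gap and the flow of chordal SLE_0(rho) *)

Section SLE.

Variables (rho x0 : R) (tau : Rbar) (W x : R -> R) (gamma : R -> C).
Hypotheses (Hx0 : 0 < x0) (HS : SLE0 rho x0 tau W x gamma).

Lemma before_le : forall t u, before tau t -> 0 <= u <= t -> before tau u.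
Proof.
  intros t u [_ Ht] Hu. split; [apply Hu|].
  apply Rbar_le_lt_trans with t; [exact (proj2 Hu) | exact Ht].
Qed.

Lemma force_derive : forall s, before tau s ->
  is_derive_on (V := R_NormedModule) (before tau) x s (2 / (x s - W s)).
Proof.
  intros s Hs. destruct (proj2 (SLE0_force _ _ _ _ _ _ HS) s Hs) as [Hn Hd].
  apply is_derive_on_fst in Hd. simpl in Hd.
  replace (2 / (x s - W s)) with (Re (RtoC 2 / (RtoC (x s) - RtoC (W s)))); [exact Hd|].
  rewrite <- RtoC_minus, <- RtoC_div; [reflexivity|].
  intros E. apply Hn. f_equal. lra.
Qed.

Lemma gap_nonzero : forall s, before tau s -> x s - W s <> 0.
Proof.
  intros s Hs E. destruct (proj2 (SLE0_force _ _ _ _ _ _ HS) s Hs) as [Hn _].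
  apply Hn. f_equal. lra.
Qed.

Lemma gap_start : x 0 - W 0 = x0.
Proof.
  rewrite (SLE0_start _ _ _ _ _ _ HS).
  assert (E := proj1 (SLE0_force _ _ _ _ _ _ HS)). apply (f_equal Re) in E.
  simpl in E. lra.
Qed.

Section Clamped.

Variable t : R.
Hypothesis (Ht : before tau t).

(** The gap between the force point and the driving point, extended from [0, t]. *)
Let Xc (u : R) : R := x (clamp t u) - W (clamp t u).

Lemma clamped_before : forall u, before tau (clamp t u).
Proof. intros u. apply before_le with t; [exact Ht | apply clamp_in, Ht]. Qed.

Lemma driving_clamped :
  (forall s, continuous (fun u => W (clamp t u)) s) /\
  (forall s, 0 < s < t ->
     is_derive (fun u => W (clamp t u)) s (rho / (W s - x s))).
Proof.
  apply (clamp_of_derive_on (before tau) W (fun s => rho / (W s - x s))).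
  - apply Ht.
  - intros u Hu. exact (before_le t u Ht Hu).
  - apply (SLE0_drive _ _ _ _ _ _ HS).
Qed.

Lemma gap_continuous : forall s, continuous Xc s.
Proof.
  intros s. apply (continuous_minus (fun u => x (clamp t u)) (fun u => W (clamp t u))).
  - apply (clamp_of_derive_on (before tau) x (fun s => 2 / (x s - W s))); [apply Ht | |].
    + intros u Hu. exact (before_le t u Ht Hu).
    + exact force_derive.
  - apply driving_clamped.
Qed.

Lemma gap_derive : forall s, 0 < s < t -> is_derive Xc s ((rho + 2) / Xc s).
Proof.
  intros s Hs. assert (Hb : before tau s) by (apply before_le with t; [exact Ht | lra]).
  assert (Hn := gap_nonzero s Hb).
  evar_last.
  - apply (is_derive_minus (fun u => x (clamp t u)) (fun u => W (clamp t u))).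
    + apply (clamp_of_derive_on (before tau) x (fun s => 2 / (x s - W s))); [apply Ht | | | exact Hs].
      * intros u Hu. exact (before_le t u Ht Hu).
      * exact force_derive.
    + apply driving_clamped, Hs.
  - unfold Xc. rewrite clamp_id by lra. unfold minus, plus, opp; simpl. field. lra.
Qed.

Lemma gap_clamped_positive : forall s, 0 < Xc s.
Proof.
  assert (H0 : forall s, 0 <= s -> 0 < Xc s).
  { intros s Hs. apply positive_of_nonzero.
    - exact Hs.
    - exact gap_continuous.
    - intros u. apply gap_nonzero, clamped_before.
    - unfold Xc. rewrite clamp_id by (split; [lra | apply Ht]). rewrite gap_start. exact Hx0. }
  intros s. unfold Xc. rewrite <- (clamp_id t (clamp t s)) by (apply clamp_in, Ht).
  apply H0. apply clamp_in, Ht.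
Qed.

Lemma gap_positive : 0 < x t - W t.
Proof.
  assert (H := gap_clamped_positive t). unfold Xc in H.
  rewrite clamp_id in H by (split; [apply Ht | lra]). exact H.
Qed.

(** [X' = (rho + 2) / X] integrates to [X_t^2 = x0^2 + 2 (rho + 2) t]. *)
Lemma gap_square : (x t - W t) ^ 2 = x0 ^ 2 + 2 * (rho + 2) * t.
Proof.
  assert (E : Xc t ^ 2 + - (2 * (rho + 2)) * t = Xc 0 ^ 2 + - (2 * (rho + 2)) * 0).
  { apply (constant_of_zero_derivative (fun s => Xc s ^ 2 + - (2 * (rho + 2)) * s)).
    - apply Ht.
    - intros s _. apply (continuous_plus (fun s => Xc s ^ 2)).
      + apply (continuous_comp Xc (fun u => u ^ 2)); [apply gap_continuous|].
        apply (ex_derive_continuous (fun u => u ^ 2)). auto_derive. exact I.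
      + apply continuous_scal_fun, continuous_id.
    - intros s Hs. evar_last.
      + apply (is_derive_plus (fun s => Xc s ^ 2)).
        * apply (is_derive_pow Xc), gap_derive, Hs.
        * apply is_derive_scal, (is_derive_id (K := R_AbsRing)).
      + assert (H := gap_clamped_positive s).
        unfold plus, one; simpl. field. lra. }
  unfold Xc in E. assert (Ht0 := proj1 Ht).
  rewrite !clamp_id in E by lra. rewrite gap_start in E. lra.
Qed.

(** The path of [z] relative to the driving function.  Its imaginary part stays positive,
    because it solves the linear equation [V' = - (2 / |Z|^2) V] and [Z] has no zero. *)
Lemma flow_of_loewner_map : forall (z : C) (y : R),
  0 < Im z -> loewner_map W t z (W t, y) ->
  exists X U V : R -> R,
    flow (rho + 2) t X U V /\
    X 0 = x0 /\ U 0 = Re z /\ V 0 = Im z /\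
    X t = x t - W t /\ U t = 0 /\ V t = y.
Proof.
  intros z y Hz [h [[Hh0 Hh] Hht]].
  assert (Ht0 := proj1 Ht).
  set (D := fun s : R => 0 <= s <= t).
  set (dh := fun s => (RtoC 2 / (h s - RtoC (W s)))%C).
  set (Uc := fun u => Re (h (clamp t u)) - W (clamp t u)).
  set (Vc := fun u => Im (h (clamp t u))).
  destruct (clamp_of_derive_on D (fun s => Re (h s)) (fun s => Re (dh s)) t Ht0)
    as [Rc Rd].
  { intros u Hu; exact Hu. }
  { intros s Hs. apply is_derive_on_fst, Hh, Hs. }
  destruct (clamp_of_derive_on D (fun s => Im (h s)) (fun s => Im (dh s)) t Ht0)
    as [Ic Id].
  { intros u Hu; exact Hu. }
  { intros s Hs. apply is_derive_on_snd, Hh, Hs. }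
  assert (Uct : forall s, continuous Uc s).
  { intros s. apply (continuous_minus (fun u => Re (h (clamp t u))));
      [apply Rc | apply driving_clamped]. }
  assert (Hnz : forall s, 0 < Uc s ^ 2 + Vc s ^ 2).
  { intros s. assert (Hn := proj1 (Hh (clamp t s) (clamp_in t s Ht0))).
    destruct (Rlt_le_dec 0 (Uc s ^ 2 + Vc s ^ 2)) as [|Hle]; [assumption|exfalso].
    apply Hn. unfold Uc, Vc in Hle.
    assert (E1 : Re (h (clamp t s)) - W (clamp t s) = 0) by nra.
    assert (E2 : Im (h (clamp t s)) = 0) by nra.
    apply injective_projections; simpl; [exact (Rminus_diag_uniq _ _ E1) | exact E2]. }
  assert (Edh : forall s, 0 < s < t ->
     Re (dh s) = 2 * Uc s / (Uc s ^ 2 + Vc s ^ 2) /\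
     Im (dh s) = - (2 * Vc s / (Uc s ^ 2 + Vc s ^ 2))).
  { intros s Hs. assert (H := Hnz s). unfold dh, Uc, Vc in *.
    rewrite !clamp_id in * by lra. destruct (h s) as [p q]. simpl in *.
    split; field; repeat split; lra. }
  assert (Vd : forall s, 0 < s < t ->
     is_derive Vc s (- (2 * Vc s / (Uc s ^ 2 + Vc s ^ 2)))).
  { intros s Hs. rewrite <- (proj2 (Edh s Hs)). apply Id, Hs. }
  assert (V0 : Vc 0 = Im z).
  { unfold Vc. rewrite clamp_id by lra. rewrite Hh0. reflexivity. }
  assert (phic : forall s, continuous (fun s => 2 / (Uc s ^ 2 + Vc s ^ 2)) s).
  { intros s. apply (continuous_comp (fun s => Uc s ^ 2 + Vc s ^ 2) (fun u => 2 / u)).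
    - apply (continuous_plus (fun s => Uc s ^ 2) (fun s => Vc s ^ 2)).
      + apply (continuous_comp Uc (fun u => u ^ 2)); [apply Uct|].
        apply (ex_derive_continuous (fun u => u ^ 2)). auto_derive. exact I.
      + apply (continuous_comp Vc (fun u => u ^ 2)); [apply Ic|].
        apply (ex_derive_continuous (fun u => u ^ 2)). auto_derive. exact I.
    - apply (ex_derive_continuous (fun u => 2 / u)). auto_derive.
      generalize (Hnz s); lra. }
  assert (Vpos0 : forall s, 0 <= s <= t -> 0 < Vc s).
  { intros s Hs. apply linear_ode_positive with (fun s => 2 / (Uc s ^ 2 + Vc s ^ 2)).
    - apply Hs.
    - exact phic.
    - exact Ic.
    - intros u Hu. evar_last; [apply Vd; lra|]. field. generalize (Hnz u); lra.
    - rewrite V0. exact Hz. }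
  exists Xc, Uc, Vc. split; [split|].
  - exact Ht0.
  - exact gap_continuous.
  - exact Uct.
  - exact Ic.
  - exact gap_clamped_positive.
  - intros s. assert (H := Vpos0 (clamp t s) (clamp_in t s Ht0)).
    unfold Vc in H. rewrite (clamp_id t (clamp t s)) in H by (apply clamp_in, Ht0). exact H.
  - exact gap_derive.
  - intros s Hs. evar_last.
    + apply (is_derive_minus (fun u => Re (h (clamp t u))));
        [apply Rd, Hs | apply driving_clamped, Hs].
    + rewrite (proj1 (Edh s Hs)).
      assert (Hn := gap_nonzero s (before_le t s Ht ltac:(lra))).
      unfold minus, plus, opp; simpl. unfold Xc. rewrite clamp_id by lra.
      assert (H := Hnz s). simpl in H. field. repeat split; lra.
  - exact Vd.
  - unfold Xc, Uc, Vc. rewrite !clamp_id by lra. rewrite gap_start, Hh0, Hht.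
    rewrite (SLE0_start _ _ _ _ _ _ HS). simpl. repeat split; lra.
Qed.

(** * The equation of the trace *)

(** [f] converges to the tip at time [t], and [f y] is mapped to [W_t + i y]; the path of
    [f y] is given relative to the driving function. *)
Let tip_approximation (f : R -> C) : Prop :=
  filterlim f (at_right 0) (locally (gamma t)) /\
  forall y, 0 < y -> 0 < Im (f y) /\
    exists X U V : R -> R,
      flow (rho + 2) t X U V /\
      X 0 = x0 /\ U 0 = Re (f y) /\ V 0 = Im (f y) /\
      X t = x t - W t /\ U t = 0 /\ V t = y.

Lemma tip_flow : exists f : R -> C, tip_approximation f.
Proof.
  destruct (SLE0_trace _ _ _ _ _ _ HS t Ht) as [f [Hf Hlim]].
  exists f. split; [exact Hlim|]. intros y Hy. destruct (Hf y Hy) as [H1 H2].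
  split; [exact H1|]. apply flow_of_loewner_map; assumption.
Qed.

Lemma tip_upper_eventually : forall f, tip_approximation f -> at_right 0 (fun y => 0 < Im (f y)).
Proof.
  intros f [_ H]. generalize at_right_pos. apply filter_imp. intros y Hy. apply H, Hy.
Qed.

Lemma tip_upper : 0 <= Im (gamma t).
Proof.
  destruct tip_flow as [f Hf].
  apply (lim_closed_half_plane (at_right 0) f); [|apply Hf].
  generalize (tip_upper_eventually f Hf). apply filter_imp. intros; lra.
Qed.

Lemma shift_start : forall (z : C) (k : R), (Re z + k * x0, Im z) = (z - RtoC (- k * x0))%C.
Proof. intros [u v] k. apply injective_projections; simpl; ring. Qed.

Lemma lim_tip_ln : forall f q, tip_approximation f -> gamma t <> RtoC q ->
  filterlim (fun y => ln (Cmod (f y - RtoC q)%C)) (at_right 0)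
    (locally (ln (Cmod (gamma t - RtoC q)%C))).
Proof.
  intros f q Hf Hq. apply (lim_ln_Cmod (at_right 0)); [apply minus_nonzero, Hq|].
  apply (lim_Cminus (at_right 0)), Hf.
Qed.

Lemma lim_tip_Arg : forall f q, tip_approximation f -> gamma t <> RtoC q ->
  filterlim (fun y => Arg (f y - RtoC q)%C) (at_right 0)
    (locally (Arg (gamma t - RtoC q)%C)).
Proof.
  intros f q Hf Hq. apply (lim_Arg (at_right 0) (fun y => (f y - RtoC q)%C)).
  - apply minus_nonzero, Hq.
  - simpl. generalize tip_upper; unfold Im; lra.
  - generalize (tip_upper_eventually f Hf). apply filter_imp. simpl. unfold Im. intros; lra.
  - apply (lim_Cminus (at_right 0)), Hf.
Qed.

(** The limit, as the point [W_t + i y] tends to [W_t], of the conservation laws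
    [conserved_ln] and [conserved_Arg].  The last argument is [0] for [a > 0] and [PI] for
    [a < 0]. *)
Lemma trace_equation : rho + 2 <> 0 -> rho + 2 <> -2 ->
  let a := rho + 2 in
  let q' := - (2 / a) * x0 in
  gamma t <> RtoC x0 /\ gamma t <> RtoC q' /\
  a * ln (Cmod (gamma t - RtoC x0)%C) + 2 * ln (Cmod (gamma t - RtoC q')%C)
    = a * ln (x t - W t) + 2 * ln (Rabs (2 / a * (x t - W t))) /\
  a * Arg (gamma t - RtoC x0)%C + 2 * Arg (gamma t - RtoC q')%C
    = a * PI + 2 * Arg (RtoC (2 / a * (x t - W t))).
Proof.
  intros Ha Ha2 a q'. change (a <> 0) in Ha. change (a <> -2) in Ha2.
  destruct tip_flow as [f Hf]. set (X := x t - W t).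
  assert (HX : 0 < X) by apply gap_positive.
  assert (Hk : 2 / a <> 0).
  { intros E. apply (Rmult_eq_compat_r a) in E. unfold Rdiv in E.
    rewrite Rmult_assoc, Rinv_l in E by exact Ha. lra. }
  assert (HkX : 2 / a * X <> 0) by (apply Rmult_integral_contrapositive_currified; lra).
  assert (Hqq : RtoC x0 <> RtoC q').
  { intros E. apply (f_equal Re) in E. simpl in E. unfold q' in E.
    assert (E2 : (a + 2) * x0 = 0).
    { replace ((a + 2) * x0) with (a * (x0 - - (2 / a) * x0)) by (field; exact Ha).
      rewrite <- E. ring. }
    apply Rmult_integral in E2. lra. }
  assert (Eln : forall y, 0 < y ->
     a * ln (Cmod (f y - RtoC x0)%C) + 2 * ln (Cmod (f y - RtoC q')%C)
     = a * ln (Cmod (- X, y)) + 2 * ln (Cmod (2 / a * X, y))).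
  { intros y Hy. destruct (proj2 Hf y Hy) as [_ [X1 [U [V [HF [E1 [E2 [E3 [E4 [E5 E6]]]]]]]]]].
    assert (E := conserved_ln _ _ _ _ _ HF Ha).
    rewrite E1, E2, E3, E4, E5, E6, !shift_start in E. fold a X q' in E.
    replace (0 + -1 * X) with (- X) in E by ring.
    replace (0 + 2 / a * X) with (2 / a * X) in E by ring.
    replace (- -1 * x0) with x0 in E by ring. symmetry. exact E. }
  assert (EArg : forall y, 0 < y ->
     a * Arg (f y - RtoC x0)%C + 2 * Arg (f y - RtoC q')%C
     = a * Arg (- X, y) + 2 * Arg (2 / a * X, y)).
  { intros y Hy. destruct (proj2 Hf y Hy) as [_ [X1 [U [V [HF [E1 [E2 [E3 [E4 [E5 E6]]]]]]]]]].
    assert (E := conserved_Arg _ _ _ _ _ HF Ha).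
    rewrite E1, E2, E3, E4, E5, E6, !shift_start in E. fold a X q' in E.
    replace (0 + -1 * X) with (- X) in E by ring.
    replace (0 + 2 / a * X) with (2 / a * X) in E by ring.
    replace (- -1 * x0) with x0 in E by ring. symmetry. exact E. }
  assert (Lln : filterlim (fun y => a * ln (Cmod (- X, y)) + 2 * ln (Cmod (2 / a * X, y)))
            (at_right 0) (locally (a * ln X + 2 * ln (Rabs (2 / a * X))))).
  { apply (lim_combine (at_right 0)); [|apply lim_boundary_ln; exact HkX].
    assert (L := lim_boundary_ln (- X) ltac:(lra)).
    rewrite Rabs_Ropp, (Rabs_pos_eq X) in L by lra. exact L. }
  assert (Hnq : gamma t <> RtoC x0).
  { refine (ln_balance_nondegenerate (at_right 0) f _ _ (RtoC q') a 2 _ _ Ha Hqq _ _ _ Lln).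
    - generalize (tip_upper_eventually f Hf). apply filter_imp.
      intros y Hy. apply nonreal_neq, Hy.
    - generalize at_right_pos. apply filter_imp. exact Eln.
    - apply Hf. }
  assert (Hnq' : gamma t <> RtoC q').
  { refine (ln_balance_nondegenerate (at_right 0) f _ _ (RtoC x0) 2 a _ _ _
                (not_eq_sym Hqq) _ _ _ Lln).
    - lra.
    - generalize (tip_upper_eventually f Hf). apply filter_imp.
      intros y Hy. apply nonreal_neq, Hy.
    - generalize at_right_pos. apply filter_imp. intros y Hy.
      rewrite <- (Eln y Hy). ring.
    - apply Hf. }
  split; [exact Hnq | split; [exact Hnq' | split]].
  - apply (filterlim_locally_unique (F := at_right 0)
      (fun y => a * ln (Cmod (f y - RtoC x0)%C) + 2 * ln (Cmod (f y - RtoC q')%C))).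
    + apply (lim_combine (at_right 0)); apply lim_tip_ln; assumption.
    + apply filterlim_ext_loc with (2 := Lln).
      generalize at_right_pos. apply filter_imp. intros y Hy. symmetry. exact (Eln y Hy).
  - apply (filterlim_locally_unique (F := at_right 0)
      (fun y => a * Arg (f y - RtoC x0)%C + 2 * Arg (f y - RtoC q')%C)).
    + apply (lim_combine (at_right 0)); apply lim_tip_Arg; assumption.
    + apply filterlim_ext_loc with (fun y => a * Arg (- X, y) + 2 * Arg (2 / a * X, y)).
      * generalize at_right_pos. apply filter_imp. intros y Hy. symmetry. exact (EArg y Hy).
      * apply (lim_combine (at_right 0)); [|apply lim_boundary_Arg; exact HkX].
        rewrite <- (Arg_neg_real (- X)) by lra. apply lim_boundary_Arg. lra.
Qed.

Lemma trace_equation_a0 : rho + 2 = 0 ->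
  gamma t <> RtoC x0 /\
  Re (gamma t) + x0 * ln (Cmod (gamma t - RtoC x0)%C) = x0 * ln x0 + 2 / x0 * t /\
  Im (gamma t) + x0 * Arg (gamma t - RtoC x0)%C = x0 * PI.
Proof.
  intros Ha. destruct tip_flow as [f Hf].
  assert (Ere : forall y, 0 < y ->
     Re (f y) + x0 * ln (Cmod (f y - RtoC x0)%C) = x0 * ln (Cmod (- x0, y)) + 2 / x0 * t).
  { intros y Hy. destruct (proj2 Hf y Hy) as [_ [X1 [U [V [HF [E1 [E2 [E3 [E4 [E5 E6]]]]]]]]]].
    assert (E := conserved_a0_re _ _ _ _ _ HF Ha).
    assert (Ht' : X1 t = X1 0) by (apply (flow_X_const _ _ _ _ _ HF Ha); split; [apply Ht | lra]).
    rewrite Ht', E1, E2, E3, E5, E6, !shift_start in E.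
    replace (0 + -1 * x0) with (- x0) in E by ring.
    replace (- -1 * x0) with x0 in E by ring. lra. }
  assert (Eim : forall y, 0 < y ->
     Im (f y) + x0 * Arg (f y - RtoC x0)%C = y + x0 * Arg (- x0, y)).
  { intros y Hy. destruct (proj2 Hf y Hy) as [_ [X1 [U [V [HF [E1 [E2 [E3 [E4 [E5 E6]]]]]]]]]].
    assert (E := conserved_a0_im _ _ _ _ _ HF Ha).
    assert (Ht' : X1 t = X1 0) by (apply (flow_X_const _ _ _ _ _ HF Ha); split; [apply Ht | lra]).
    rewrite Ht', E1, E2, E3, E5, E6, !shift_start in E.
    replace (0 + -1 * x0) with (- x0) in E by ring.
    replace (- -1 * x0) with x0 in E by ring. lra. }
  assert (Lre := lim_Re (at_right 0) f _ (proj1 Hf)).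
  assert (Lim := lim_Im (at_right 0) f _ (proj1 Hf)).
  assert (Lr : filterlim (fun y => x0 * ln (Cmod (- x0, y)) + 2 / x0 * t)
                 (at_right 0) (locally (x0 * ln x0 + 2 / x0 * t))).
  { apply (lim_plus (at_right 0)); [|apply filterlim_const]. apply (lim_scal (at_right 0)).
    assert (L := lim_boundary_ln (- x0) ltac:(lra)).
    rewrite Rabs_Ropp, (Rabs_pos_eq x0) in L by lra. exact L. }
  assert (Hnq : gamma t <> RtoC x0).
  { intros Hc.
    assert (L : filterlim (fun y => ln (Cmod (f y - RtoC x0)%C)) (at_right 0)
                  (locally (/ x0 * (x0 * ln x0 + 2 / x0 * t + -1 * Re (gamma t))))).
    { apply filterlim_ext_loc with
        (fun y => / x0 * (x0 * ln (Cmod (- x0, y)) + 2 / x0 * t + -1 * Re (f y))).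
      - generalize at_right_pos. apply filter_imp. intros y Hy. rewrite <- (Ere y Hy).
        field. lra.
      - apply (lim_scal (at_right 0)), (lim_plus (at_right 0)); [exact Lr|].
        apply (lim_scal (at_right 0)), Lre. }
    refine (lim_nonzero_of_ln (at_right 0) (fun y => (f y - RtoC x0)%C)
              (gamma t - RtoC x0)%C _ _ _ L _).
    - generalize (tip_upper_eventually f Hf). apply filter_imp.
      intros y Hy. apply minus_nonzero, nonreal_neq, Hy.
    - apply (lim_Cminus (at_right 0)), Hf.
    - rewrite Hc. ring. }
  split; [exact Hnq | split].
  - apply (filterlim_locally_unique (F := at_right 0)
      (fun y => Re (f y) + x0 * ln (Cmod (f y - RtoC x0)%C))).
    + apply (lim_plus (at_right 0)); [exact Lre|].
      apply (lim_scal (at_right 0)), lim_tip_ln; assumption.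
    + apply filterlim_ext_loc with (2 := Lr).
      generalize at_right_pos. apply filter_imp. intros y Hy. symmetry. exact (Ere y Hy).
  - apply (filterlim_locally_unique (F := at_right 0)
      (fun y => Im (f y) + x0 * Arg (f y - RtoC x0)%C)).
    + apply (lim_plus (at_right 0)); [exact Lim|].
      apply (lim_scal (at_right 0)), lim_tip_Arg; assumption.
    + apply filterlim_ext_loc with (fun y => y + x0 * Arg (- x0, y)).
      * generalize at_right_pos. apply filter_imp. intros y Hy. symmetry. exact (Eim y Hy).
      * replace (x0 * PI) with (0 + x0 * PI) by ring.
        apply (lim_plus (at_right 0)).
        -- intros P HP. apply filter_le_within. exact HP.
        -- apply (lim_scal (at_right 0)). rewrite <- (Arg_neg_real (- x0)) by lra.
           apply lim_boundary_Arg. lra.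
Qed.

Lemma trace_equation_am2 : rho + 2 = -2 ->
  let r := Cmod (gamma t - RtoC x0)%C in
  gamma t <> RtoC x0 /\
  ln r + -1 * (x0 * (Re (gamma t - RtoC x0)%C / r ^ 2)) = ln (x t - W t) + 1 /\
  Arg (gamma t - RtoC x0)%C + x0 * (Im (gamma t - RtoC x0)%C / r ^ 2) = PI.
Proof.
  intros Ha r. destruct tip_flow as [f Hf]. set (X := x t - W t).
  assert (HX : 0 < X) by apply gap_positive.
  set (g := fun y => (f y - RtoC x0)%C).
  set (c := (gamma t - RtoC x0)%C). change (Cmod c) with r.
  assert (Lg : filterlim g (at_right 0) (locally c)) by (apply (lim_Cminus (at_right 0)), Hf).
  assert (Ere : forall y, 0 < y ->
     ln (Cmod (g y)) + -1 * (x0 * (Re (g y) / Cmod (g y) ^ 2))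
     = ln (Cmod (- X, y)) + X ^ 2 / (X ^ 2 + y ^ 2)).
  { intros y Hy. destruct (proj2 Hf y Hy) as [_ [X1 [U [V [HF [E1 [E2 [E3 [E4 [E5 E6]]]]]]]]]].
    assert (E := conserved_am2_re _ _ _ _ _ HF Ha).
    rewrite E1, E2, E3, E4, E5, E6, !shift_start in E. fold X in E.
    replace (0 + -1 * X) with (- X) in E by ring.
    replace (- -1 * x0) with x0 in E by ring. fold (g y) in E.
    rewrite Cmod2_alt. replace (Re (g y)) with (Re (f y) + -1 * x0) by (simpl; unfold Re; ring).
    replace (Im (g y)) with (Im (f y)) by (simpl; unfold Im; ring).
    rewrite <- E. simpl. field. nra. }
  assert (Eim : forall y, 0 < y ->
     Arg (g y) + x0 * (Im (g y) / Cmod (g y) ^ 2)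
     = Arg (- X, y) + X * y / (X ^ 2 + y ^ 2)).
  { intros y Hy. destruct (proj2 Hf y Hy) as [_ [X1 [U [V [HF [E1 [E2 [E3 [E4 [E5 E6]]]]]]]]]].
    assert (E := conserved_am2_im _ _ _ _ _ HF Ha).
    rewrite E1, E2, E3, E4, E5, E6, !shift_start in E. fold X in E.
    replace (0 + -1 * X) with (- X) in E by ring.
    replace (- -1 * x0) with x0 in E by ring. fold (g y) in E.
    rewrite Cmod2_alt. replace (Re (g y)) with (Re (f y) + -1 * x0) by (simpl; unfold Re; ring).
    replace (Im (g y)) with (Im (f y)) by (simpl; unfold Im; ring).
    rewrite <- E. simpl. field. nra. }
  assert (Lr : filterlim (fun y => ln (Cmod (- X, y)) + X ^ 2 / (X ^ 2 + y ^ 2))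
                 (at_right 0) (locally (ln X + 1))).
  { apply (lim_plus (at_right 0)).
    - assert (L := lim_boundary_ln (- X) ltac:(lra)).
      rewrite Rabs_Ropp, (Rabs_pos_eq X) in L by lra. exact L.
    - replace 1 with (X ^ 2 / (X ^ 2 + 0 ^ 2)) by (field; nra).
      apply (lim_map (at_right 0) (fun y => X ^ 2 / (X ^ 2 + y ^ 2)) (fun y => y) 0).
      + apply (ex_derive_continuous (fun y => X ^ 2 / (X ^ 2 + y ^ 2))). auto_derive. nra.
      + intros P HP. apply filter_le_within. exact HP. }
  assert (Li : filterlim (fun y => Arg (- X, y) + X * y / (X ^ 2 + y ^ 2))
                 (at_right 0) (locally PI)).
  { replace PI with (PI + X * 0 / (X ^ 2 + 0 ^ 2)) by (field; nra).
    apply (lim_plus (at_right 0)).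
    - rewrite <- (Arg_neg_real (- X)) by lra. apply lim_boundary_Arg. lra.
    - apply (lim_map (at_right 0) (fun y => X * y / (X ^ 2 + y ^ 2)) (fun y => y) 0).
      + apply (ex_derive_continuous (fun y => X * y / (X ^ 2 + y ^ 2))). auto_derive. nra.
      + intros P HP. apply filter_le_within. exact HP. }
  assert (Hgpos : at_right 0 (fun y => 0 < Im (g y))).
  { generalize (tip_upper_eventually f Hf). apply filter_imp.
    intros y Hy. unfold g. simpl. unfold Im in Hy. lra. }
  assert (Hc0 : 0 < r).
  { assert (Hpi := PI_RGT_0).
    set (M := Rabs (ln X + 1) + PI + 1).
    assert (HM := Rabs_pos (ln X + 1)).
    destruct (log_minus_pole_nondegenerate x0 M Hx0) as [d [Hd Hdr]]; [unfold M; lra|].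
    destruct (Rlt_le_dec 0 r) as [|Hr]; [assumption|exfalso].
    assert (Hr' : 0 <= r) by apply Cmod_ge_0. assert (Hr0 : r = 0) by lra.
    assert (HFalse : at_right 0 (fun _ => False)).
    { generalize (filter_and _ _ (filter_and _ _ at_right_pos Hgpos)
        (filter_and _ _ (proj1 (lim_R (at_right 0) _ _) (lim_Cmod (at_right 0) g c Lg) d Hd)
           (filter_and _ _ (proj1 (lim_R (at_right 0) _ _) Lr 1 Rlt_0_1)
                           (proj1 (lim_R (at_right 0) _ _) Li 1 Rlt_0_1)))).
      apply filter_imp. intros y [[Hy Hi] [H1 [H2 H3]]].
      change (Cmod c) with r in H1. rewrite Hr0, Rminus_0_r, Rabs_pos_eq in H1 by apply Cmod_ge_0.
      assert (Hm : 0 < Cmod (g y)) by (apply Cmod_gt_0, Im_pos_nonzero, Hi).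
      apply (Rlt_not_le _ _ H1).
      apply (Hdr _ (Re (g y)) (Im (g y)) (Arg (g y)) Hm (Cmod2_alt (g y))).
      - apply Arg_bounds. lra.
      - rewrite (Ere y Hy). unfold M.
        replace (ln (Cmod (- X, y)) + X ^ 2 / (X ^ 2 + y ^ 2))
          with ((ln (Cmod (- X, y)) + X ^ 2 / (X ^ 2 + y ^ 2) - (ln X + 1)) + (ln X + 1)) by ring.
        eapply Rle_trans; [apply Rabs_triang|]. lra.
      - rewrite (Eim y Hy). unfold M.
        replace (Arg (- X, y) + X * y / (X ^ 2 + y ^ 2))
          with ((Arg (- X, y) + X * y / (X ^ 2 + y ^ 2) - PI) + PI) by ring.
        eapply Rle_trans; [apply Rabs_triang|]. rewrite (Rabs_pos_eq PI) by lra. lra. }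
    destruct (at_right_proper_filter 0) as [Hex _]. destruct (Hex _ HFalse) as [_ []]. }
  assert (Hnq : gamma t <> RtoC x0).
  { intros E. unfold r in Hc0. rewrite E in Hc0.
    replace (RtoC x0 - RtoC x0)%C with (RtoC 0) in Hc0 by ring. rewrite Cmod_0 in Hc0. lra. }
  assert (Linv : filterlim (fun y => / Cmod (g y) ^ 2) (at_right 0) (locally (/ r ^ 2))).
  { apply (lim_map (at_right 0) (fun u => / u ^ 2) (fun y => Cmod (g y)) r).
    - apply (ex_derive_continuous (fun u => / u ^ 2)). auto_derive. nra.
    - apply (lim_Cmod (at_right 0)), Lg. }
  split; [exact Hnq | split].
  - apply (filterlim_locally_unique (F := at_right 0)
      (fun y => ln (Cmod (g y)) + -1 * (x0 * (Re (g y) / Cmod (g y) ^ 2)))).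
    + apply (lim_plus (at_right 0)); [apply lim_tip_ln; assumption|].
      apply (lim_scal (at_right 0)), (lim_scal (at_right 0)).
      apply (lim_mult (at_right 0)); [apply (lim_Re (at_right 0)), Lg | exact Linv].
    + apply filterlim_ext_loc with (2 := Lr).
      generalize at_right_pos. apply filter_imp. intros y Hy. symmetry. exact (Ere y Hy).
  - apply (filterlim_locally_unique (F := at_right 0)
      (fun y => Arg (g y) + x0 * (Im (g y) / Cmod (g y) ^ 2))).
    + apply (lim_plus (at_right 0)); [apply lim_tip_Arg; assumption|].
      apply (lim_scal (at_right 0)).
      apply (lim_mult (at_right 0)); [apply (lim_Im (at_right 0)), Lg | exact Linv].
    + apply filterlim_ext_loc with (2 := Li).
      generalize at_right_pos. apply filter_imp. intros y Hy. symmetry. exact (Eim y Hy).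
Qed.

End Clamped.

End SLE.

(** * Life time *)

Global Instance left_of_filter (tau : Rbar) : Filter (left_of tau).
Proof. unfold left_of. apply within_filter. destruct tau; apply Rbar_locally_filter. Qed.

Lemma left_of_finite : forall (T : R) (P : R -> Prop),
  (exists d, 0 < d /\ forall t, T - d < t < T -> P t) -> left_of (Finite T) P.
Proof.
  intros T P [d [Hd H]]. exists (mkposreal d Hd). intros t Ht Hlt.
  change (Rabs (t - T) < d) in Ht. simpl in Hlt. apply Rabs_lt_between in Ht. apply H. lra.
Qed.

Lemma left_of_infinite : forall (P : R -> Prop),
  (exists M, forall t, M < t -> P t) -> left_of p_infty P.
Proof. intros P [M H]. exists M. intros t Ht _. apply H, Ht. Qed.

Section LifeTime.

Variables (rho x0 : R) (tau : Rbar) (W x : R -> R) (gamma : R -> C).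
Hypotheses (Hx0 : 0 < x0) (HS : SLE0 rho x0 tau W x gamma).

Let gap_pos t (Ht : before tau t) := gap_positive rho x0 tau W x gamma Hx0 HS t Ht.
Let gap_sq t (Ht : before tau t) := gap_square rho x0 tau W x gamma Hx0 HS t Ht.

(** Levels that the gap never attains have hitting time [+oo]; since the hitting times
    of small levels converge to [tau], the gap must take small values if [tau] is not
    [+oo]. *)
Lemma gap_small : tau <> p_infty ->
  forall e, 0 < e -> exists t, before tau t /\ x t - W t < e.
Proof.
  intros Htau e He. apply NNPP. intros Hno.
  assert (Hbig : forall t, before tau t -> e <= x t - W t).
  { intros t Ht. destruct (Rlt_le_dec (x t - W t) e) as [H|]; [|assumption].
    exfalso. apply Hno. exists t. split; assumption. }
  assert (Hinf : forall eps, eps < e -> hitting_time tau W x eps = p_infty).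
  { intros eps Heps. unfold hitting_time.
    destruct (Glb_Rbar_correct (fun t => before tau t /\ Rabs (W t - x t) = eps)) as [_ Hg].
    assert (H : Rbar_le p_infty
      (Glb_Rbar (fun t => before tau t /\ Rabs (W t - x t) = eps))).
    { apply Hg. intros t [Ht E]. exfalso.
      assert (H1 := Hbig t Ht). rewrite Rabs_minus_sym in E.
      generalize (Rle_abs (x t - W t)). lra. }
    destruct (Glb_Rbar _); [contradiction | reflexivity | contradiction]. }
  assert (Hn : Rbar_nhds tau (fun y => y <> p_infty)).
  { destruct tau as [r| |]; simpl.
    - apply filter_forall. discriminate.
    - contradiction Htau. reflexivity.
    - exists 0. intros y Hy E. rewrite E in Hy. exact Hy. }
  assert (Hlt : at_right 0 (fun eps => eps < e)).
  { apply filter_le_within. apply open_lt. exact He. }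
  assert (HFalse : at_right 0 (fun _ : R => False)).
  { generalize (filter_and _ _ Hlt (SLE0_time _ _ _ _ _ _ HS _ Hn)).
    apply filter_imp. intros eps [H1 H2]. apply H2, Hinf, H1. }
  destruct (at_right_proper_filter 0) as [Hex _]. destruct (Hex _ HFalse) as [_ []].
Qed.

Lemma lifetime_infinite : 0 <= rho + 2 -> tau = p_infty.
Proof.
  intros Ha. apply NNPP. intros Htau.
  destruct (gap_small Htau x0 Hx0) as [t [Ht Hlt]].
  assert (H1 := gap_pos t Ht). assert (H2 := gap_sq t Ht).
  assert (0 <= (rho + 2) * t) by (apply Rmult_le_pos; [exact Ha | apply Ht]). nra.
Qed.

Lemma lifetime_finite : rho + 2 < 0 -> tau = Finite (- (x0 ^ 2 / (2 * (2 + rho)))).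
Proof.
  intros Ha. set (T := - (x0 ^ 2 / (2 * (2 + rho)))).
  assert (HT : x0 ^ 2 + 2 * (rho + 2) * T = 0) by (unfold T; field; lra).
  assert (HT0 : 0 < T) by nra.
  assert (HnT : ~ before tau T).
  { intros Hb. assert (H1 := gap_pos T Hb). assert (H2 := gap_sq T Hb). nra. }
  assert (Htau : tau <> p_infty).
  { intros E. apply HnT. rewrite E. split; [lra | exact I]. }
  assert (Hsmall := gap_small Htau).
  destruct tau as [r| |].
  - f_equal. apply Rle_antisym.
    + destruct (Rle_lt_dec r T) as [|Hlt]; [assumption|].
      exfalso. apply HnT. split; [lra | exact Hlt].
    + destruct (Rle_lt_dec T r) as [|Hlt]; [assumption|exfalso].
      set (e := sqrt (2 * (rho + 2) * (r - T))).
      assert (Hp : 0 < 2 * (rho + 2) * (r - T)) by nra.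
      assert (He : 0 < e) by (apply sqrt_lt_R0, Hp).
      assert (He2 : e * e = 2 * (rho + 2) * (r - T)) by (apply sqrt_sqrt; lra).
      destruct (Hsmall e He) as [t [Ht Hte]].
      assert (H1 := gap_pos t Ht). assert (H2 := gap_sq t Ht).
      destruct Ht as [Ht0 Htr]. simpl in Htr. nra.
  - contradiction Htau. reflexivity.
  - destruct (Hsmall 1 Rlt_0_1) as [t [[_ Ht] _]]. destruct Ht.
Qed.

Lemma gap_tends_to_0 : rho + 2 < 0 ->
  forall e, 0 < e -> left_of tau (fun t => before tau t /\ x t - W t < e).
Proof.
  intros Ha e He. assert (Etau := lifetime_finite Ha).
  set (T := - (x0 ^ 2 / (2 * (2 + rho)))) in *.
  assert (HT : x0 ^ 2 + 2 * (rho + 2) * T = 0) by (unfold T; field; lra).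
  assert (HT0 : 0 < T) by nra.
  enough (H : left_of (Finite T) (fun t => before tau t /\ x t - W t < e))
    by (rewrite <- Etau in H; exact H).
  apply left_of_finite. exists (Rmin T (e ^ 2 / (- (2 * (rho + 2))))).
  split.
  - apply Rmin_glb_lt; [exact HT0|]. apply Rdiv_lt_0_compat; [nra | lra].
  - intros t Ht. assert (M1 := Rmin_l T (e ^ 2 / (- (2 * (rho + 2))))).
    assert (M2 := Rmin_r T (e ^ 2 / (- (2 * (rho + 2))))).
    assert (Hb : before tau t) by (rewrite Etau; split; [lra | simpl; lra]).
    split; [exact Hb|].
    assert (H1 := gap_pos t Hb). assert (H2 := gap_sq t Hb).
    assert (H3 : - (2 * (rho + 2)) * (T - t) < e ^ 2).
    { apply Rlt_le_trans with (- (2 * (rho + 2)) * (e ^ 2 / (- (2 * (rho + 2))))).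
      - apply Rmult_lt_compat_l; lra.
      - right. field. lra. }
    nra.
Qed.

Lemma gap_tends_to_infinity : 0 < rho + 2 ->
  forall M, left_of tau (fun t => before tau t /\ M < x t - W t).
Proof.
  intros Ha M. assert (Etau := lifetime_infinite (Rlt_le _ _ Ha)).
  enough (H : left_of p_infty (fun t => before tau t /\ M < x t - W t))
    by (rewrite <- Etau in H; exact H).
  apply left_of_infinite. exists (M ^ 2 / (2 * (rho + 2))). intros t Ht.
  assert (Hq : 0 <= M ^ 2 / (2 * (rho + 2))).
  { apply Rmult_le_pos; [apply pow2_ge_0 | left; apply Rinv_0_lt_compat; lra]. }
  assert (Hb : before tau t) by (rewrite Etau; split; [lra | exact I]).
  split; [exact Hb|].
  assert (H1 := gap_pos t Hb). assert (H2 := gap_sq t Hb).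
  assert (H3 : M ^ 2 < 2 * (rho + 2) * t).
  { apply Rle_lt_trans with (2 * (rho + 2) * (M ^ 2 / (2 * (rho + 2)))).
    - right. field. lra.
    - apply Rmult_lt_compat_l; lra. }
  nra.
Qed.

End LifeTime.

(** * Landing on the real line *)

Lemma Cmod_real_shift : forall (z : C) (q q' : R),
  Cmod (z - RtoC q)%C <= Cmod (z - RtoC q')%C + Rabs (q - q').
Proof.
  intros z q q'. replace (z - RtoC q)%C with ((z - RtoC q') + RtoC (q' - q))%C
    by (rewrite RtoC_minus; ring).
  eapply Rle_trans; [apply Cmod_triangle|]. rewrite Cmod_R, Rabs_minus_sym. lra.
Qed.

Lemma Im_real_shift : forall (z : C) (q : R), Im (z - RtoC q)%C = Im z.
Proof. intros [u v] q. simpl. ring. Qed.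

Lemma Cmod_minus_pos : forall (z w : C), z <> w -> 0 < Cmod (z - w)%C.
Proof. intros z w H. apply Cmod_gt_0, minus_nonzero, H. Qed.

(** A straight ray from [q] through a point of the upper half-plane reaches infinity; if
    the curve has no point with the same argument about [q], it avoids the ray. *)
Lemma ray_unbounded :
  forall (tau : Rbar) (gamma : R -> C) (q : R) (z : C),
    0 < Im z ->
    (forall t, before tau t -> 0 < Im (gamma t) ->
       Arg (gamma t - RtoC q)%C <> Arg (z - RtoC q)%C) ->
    in_unbounded_component (complement_of_trace tau gamma) z.
Proof.
  intros tau gamma q z Hz Havoid M.
  assert (Hzq : (z - RtoC q)%C <> 0) by (apply minus_nonzero, nonreal_neq, Hz).
  assert (Hm := proj1 (Cmod_gt_0 _) Hzq).
  set (L := (Rabs M + Rabs q + 1) / Cmod (z - RtoC q)%C).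
  assert (HL : 0 < L).
  { apply Rdiv_lt_0_compat; [|exact Hm].
    generalize (Rabs_pos M) (Rabs_pos q). lra. }
  set (p := fun s : R => (RtoC q + RtoC (1 + s * L) * (z - RtoC q))%C).
  exists (p 1), p. split; [|split; [|split; [reflexivity|]]].
  - assert (H := Cmod_triangle (p 1) (- RtoC q)%C).
    rewrite Cmod_opp, Cmod_R in H.
    replace (p 1 + - RtoC q)%C with (RtoC (1 + 1 * L) * (z - RtoC q))%C in H
      by (unfold p; ring).
    rewrite Cmod_mult, Cmod_R, Rabs_pos_eq in H by lra.
    assert (E : L * Cmod (z - RtoC q)%C = Rabs M + Rabs q + 1) by (unfold L; field; lra).
    generalize (Rle_abs M). lra.
  - unfold p. rewrite Rmult_0_l, Rplus_0_r. ring.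
  - intros s Hs. assert (Hk : 0 < 1 + s * L) by nra.
    assert (Hip : Im (p s) = (1 + s * L) * Im z).
    { unfold p. destruct z as [u v]. simpl. ring. }
    assert (Hp0 : 0 < Im (p s)) by (rewrite Hip; apply Rmult_lt_0_compat; assumption).
    split.
    + split; [exact Hp0|]. intros t Ht E.
      apply (Havoid t Ht); rewrite E; [exact Hp0|].
      replace (p s - RtoC q)%C with (RtoC (1 + s * L) * (z - RtoC q))%C by (unfold p; ring).
      apply Arg_scale; [exact Hk | rewrite Im_real_shift; lra | exact Hzq].
    + refine (filterlim_filter_le_1 (F := locally s) _ (filter_le_within _) _).
      apply filterlim_ext with
        (fun s => (q + (1 + s * L) * (Re z - q), (1 + s * L) * Im z) : C).
      { intros u. apply injective_projections; unfold p; destruct z; simpl; ring. }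
      replace (p s) with ((q + (1 + s * L) * (Re z - q), (1 + s * L) * Im z) : C)
        by (apply injective_projections; unfold p; destruct z; simpl; ring).
      apply (lim_pair (locally s)).
      * apply (ex_derive_continuous (fun s => q + (1 + s * L) * (Re z - q))).
        auto_derive. exact I.
      * apply (ex_derive_continuous (fun s => (1 + s * L) * Im z)).
        auto_derive. exact I.
Qed.

Lemma Arg_interior : forall z : C, 0 < Arg z < PI -> z <> 0 -> 0 < Im z.
Proof.
  intros z Ha Hz. assert (Hpi := PI_RGT_0).
  destruct (Rle_lt_dec 0 (Im z)) as [Hi|Hi].
  - assert (Hs := sin_gt_0 _ (proj1 Ha) (proj2 Ha)). rewrite sin_Arg in Hs by assumption.
    apply Cmod_gt_0 in Hz. apply Rmult_lt_reg_r with (/ Cmod z);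
      [apply Rinv_0_lt_compat, Hz|]. rewrite Rmult_0_l. exact Hs.
  - exfalso. unfold Arg in Ha. destruct (Rle_dec 0 (Im z)); [lra|].
    generalize (acos_bound (Re z / Cmod z)). lra.
Qed.

(** A curve on which [m log (z - q) + n log (z - q')] has imaginary part [(m + n) pi] and
    real part tending to [- oo], with weights [m > 0 > n] and [m + n > 0], converges
    to [q].  As the other point [q'] lies to the left of [q], the argument about [q'] tends
    to [0], which gives the angle at [q].  The argument about [q] is never below its limit,
    so that the rays in the outer sector do not meet the curve. *)
Lemma landing :
  forall (tau : Rbar) (gamma : R -> C) (X : R -> R) (q q' m n k : R),
    0 < m -> n < 0 -> 0 < m + n -> q' < q ->
    (forall t, before tau t ->
       0 < X t /\ 0 <= Im (gamma t) /\ gamma t <> RtoC q /\ gamma t <> RtoC q' /\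
       m * ln (Cmod (gamma t - RtoC q)%C) + n * ln (Cmod (gamma t - RtoC q')%C)
         = (m + n) * ln (X t) + k /\
       m * Arg (gamma t - RtoC q)%C + n * Arg (gamma t - RtoC q')%C = (m + n) * PI) ->
    (forall e, 0 < e -> left_of tau (fun t => before tau t /\ X t < e)) ->
    filterlim gamma (left_of tau) (locally (RtoC q)) /\
    outer_hitting_angle tau gamma q (PI * ((m + n) / m)).
Proof.
  intros tau gamma X q q' m n k Hm Hn Hmn Hqq Hcurve HX.
  assert (Hpi := PI_RGT_0).
  assert (Hbefore : left_of tau (before tau)).
  { generalize (HX 1 Rlt_0_1). apply filter_imp. intros t Ht; apply Ht. }
  assert (Hlim : filterlim gamma (left_of tau) (locally (RtoC q))).
  { apply (lim_C (left_of tau)). intros d Hd.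
    (* a lower bound of the combination of logarithms where [|z - q| >= d], obtained from
       [|z - q'| <= |z - q| * (1 + (q - q') / d)] *)
    set (K := (m + n) * ln d + n * ln (1 + (q - q') / d)).
    generalize (HX (exp ((K - k) / (m + n))) (exp_pos _)). apply filter_imp.
    intros t [Ht HXt]. destruct (Hcurve t Ht) as [HX0 [_ [Hq [Hq' [Eln _]]]]].
    set (r := Cmod (gamma t - RtoC q)%C) in *. set (s := Cmod (gamma t - RtoC q')%C) in *.
    destruct (Rlt_le_dec r d) as [|Hr]; [assumption|exfalso].
    assert (Hr0 : 0 < r) by lra.
    assert (Hs0 : 0 < s) by apply Cmod_minus_pos, Hq'.
    assert (Hd1 : 0 < (q - q') / d) by (apply Rdiv_lt_0_compat; lra).
    assert (Hsr : s <= r * (1 + (q - q') / d)).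
    { apply Rle_trans with (r + (q - q')).
      - unfold r, s. eapply Rle_trans; [apply (Cmod_real_shift _ q' q)|].
        rewrite Rabs_minus_sym, Rabs_pos_eq by lra. lra.
      - assert (E : (q - q') = d * ((q - q') / d)) by (field; lra).
        rewrite E at 1. assert (d * ((q - q') / d) <= r * ((q - q') / d))
          by (apply Rmult_le_compat_r; lra). lra. }
    assert (Hln : ln s <= ln r + ln (1 + (q - q') / d)).
    { rewrite <- ln_mult by lra. apply ln_le; assumption. }
    assert (Hlr : ln d <= ln r) by (apply ln_le; lra).
    assert (HlX : ln (X t) < (K - k) / (m + n)).
    { rewrite <- (ln_exp ((K - k) / (m + n))). apply ln_increasing; assumption. }
    assert (HlX' : (m + n) * ln (X t) < K - k).
    { apply Rlt_le_trans with ((m + n) * ((K - k) / (m + n))).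
      - apply Rmult_lt_compat_l; assumption.
      - right. field. lra. }
    assert (H1 : n * (ln r + ln (1 + (q - q') / d)) <= n * ln s) by nra.
    assert (H2 : (m + n) * ln d <= (m + n) * ln r) by nra.
    unfold K in HlX'. lra. }
  split; [exact Hlim|]. split; [split|].
  - generalize Hbefore. apply filter_imp. intros t Ht. apply (Hcurve t Ht).
  - assert (L' : filterlim (fun t => Arg (gamma t - RtoC q')%C) (left_of tau) (locally 0)).
    { rewrite <- (Arg_pos_real (q - q')) by lra.
      apply (lim_Arg (left_of tau) (fun t => (gamma t - RtoC q')%C)).
      - intros E. apply (f_equal Re) in E. simpl in E. lra.
      - simpl. lra.
      - generalize Hbefore. apply filter_imp. intros t Ht. rewrite Im_real_shift.
        apply (Hcurve t Ht).
      - rewrite RtoC_minus. apply (lim_Cminus (left_of tau)), Hlim. }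
    apply filterlim_ext_loc with
      (fun t => / m * ((m + n) * PI + - n * Arg (gamma t - RtoC q')%C)).
    + generalize Hbefore. apply filter_imp. intros t Ht.
      destruct (Hcurve t Ht) as [_ [_ [_ [_ [_ E]]]]]. rewrite <- E. field. lra.
    + replace (PI * ((m + n) / m)) with (/ m * ((m + n) * PI + - n * 0)) by (field; lra).
      apply (lim_scal (left_of tau)), (lim_plus (left_of tau)); [apply filterlim_const|].
      apply (lim_scal (left_of tau)), L'.
  - intros eps Heps. exists 1. split; [lra|]. intros z [Hz0 _] Hz.
    assert (Hzq : (z - RtoC q)%C <> 0) by (apply Cmod_gt_0, Hz0).
    assert (Hlt : PI * ((m + n) / m) < PI).
    { rewrite <- (Rmult_1_r PI) at 2. apply Rmult_lt_compat_l; [exact Hpi|].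
      apply Rmult_lt_reg_r with m; [exact Hm|]. unfold Rdiv.
      rewrite Rmult_assoc, Rinv_l by lra. lra. }
    assert (Hiz : 0 < Im z).
    { rewrite <- (Im_real_shift z q). apply Arg_interior; [lra | exact Hzq]. }
    apply ray_unbounded with q; [exact Hiz|]. intros t Ht Hi E.
    destruct (Hcurve t Ht) as [_ [Hi0 [_ [_ [_ EA]]]]]. rewrite E in EA.
    assert (HA' : 0 <= Arg (gamma t - RtoC q')%C)
      by (apply Arg_bounds; rewrite Im_real_shift; exact Hi0).
    assert (HA : m * (PI * ((m + n) / m)) <= m * Arg (z - RtoC q)%C).
    { replace (m * (PI * ((m + n) / m))) with ((m + n) * PI) by (field; lra).
      rewrite <- EA. assert (n * Arg (gamma t - RtoC q')%C <= 0) by nra. lra. }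
    apply Rmult_le_reg_l in HA; lra.
Qed.

(** The degenerate case with a pole next to the logarithm, [log z - k / z] about [q]: the
    curve arrives tangentially to the real line, from the right, so that the outer sector
    is empty. *)
Lemma landing_pole :
  forall (tau : Rbar) (gamma : R -> C) (X : R -> R) (q k : R),
    0 < k ->
    (forall t, before tau t ->
       0 < X t /\ 0 <= Im (gamma t) /\ gamma t <> RtoC q /\
       let z := (gamma t - RtoC q)%C in
       ln (Cmod z) + -1 * (k * (Re z / Cmod z ^ 2)) = ln (X t) + 1 /\
       Arg z + k * (Im z / Cmod z ^ 2) = PI) ->
    (forall e, 0 < e -> left_of tau (fun t => before tau t /\ X t < e)) ->
    filterlim gamma (left_of tau) (locally (RtoC q)) /\
    outer_hitting_angle tau gamma q 0.
Proof.
  intros tau gamma X q k Hk Hcurve HX.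
  assert (Hpi := PI_RGT_0).
  assert (Hbefore : left_of tau (before tau)).
  { generalize (HX 1 Rlt_0_1). apply filter_imp. intros t Ht; apply Ht. }
  assert (Hsmall : forall K, left_of tau (fun t => before tau t /\ ln (X t) + 1 < K)).
  { intros K. generalize (HX (exp (K - 1)) (exp_pos _)). apply filter_imp.
    intros t [Ht Hlt]. split; [exact Ht|]. destruct (Hcurve t Ht) as [H0 _].
    apply ln_increasing in Hlt; [|exact H0]. rewrite ln_exp in Hlt. lra. }
  assert (Hlim : forall d, 0 < d ->
            left_of tau (fun t => Cmod (gamma t - RtoC q)%C < d)).
  { intros d Hd. generalize (Hsmall (ln d - k / d)). apply filter_imp.
    (* [ln d - k / d] bounds the real part below where [|z| >= d] *)
    intros t [Ht HK]. destruct (Hcurve t Ht) as [_ [_ [Hq [E _]]]].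
    set (z := (gamma t - RtoC q)%C) in *. set (r := Cmod z) in *.
    destruct (Rlt_le_dec r d) as [|Hr]; [assumption|exfalso].
    assert (H1 : Re z <= r) by (eapply Rle_trans; [apply Rle_abs | apply re_le_Cmod]).
    assert (H2 : Re z / r ^ 2 <= / d).
    { apply Rle_trans with (r / r ^ 2).
      - apply Rmult_le_compat_r; [left; apply Rinv_0_lt_compat; nra | exact H1].
      - replace (r / r ^ 2) with (/ r) by (field; lra). apply Rinv_le_contravar; assumption. }
    assert (H3 : k * (Re z / r ^ 2) <= k / d) by (apply Rmult_le_compat_l; lra).
    assert (H4 : ln d <= ln r) by (apply ln_le; assumption). lra. }
  split; [apply (lim_C (left_of tau)), Hlim|]. split; [split|].
  - generalize Hbefore. apply filter_imp. intros t Ht. apply (Hcurve t Ht).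
  - apply (lim_R (left_of tau)). intros eps Heps.
    set (e := Rmin eps (PI / 3)).
    assert (He : 0 < e <= PI / 3)
      by (split; [apply Rmin_glb_lt; lra | apply Rmin_r]).
    assert (Hse : 0 < sin e) by (apply sin_gt_0; lra).
    assert (Hd : 0 < k * sin e / PI)
      by (apply Rdiv_lt_0_compat; [apply Rmult_lt_0_compat; assumption | exact Hpi]).
    generalize (filter_and _ _ (Hlim _ Hd) (Hsmall (ln (k / 2)))).
    apply filter_imp. intros t [Hr [Ht HK]].
    destruct (Hcurve t Ht) as [_ [Hi [Hq [Eln EA]]]].
    set (z := (gamma t - RtoC q)%C) in *.
    assert (Hiz : 0 <= Im z) by (unfold z; rewrite Im_real_shift; exact Hi).
    assert (Hz0 : z <> 0) by apply minus_nonzero, Hq.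
    assert (Hr0 := proj1 (Cmod_gt_0 z) Hz0).
    assert (HA := Arg_bounds z Hiz).
    assert (Esin := sin_Arg z Hiz Hz0). assert (Ecos := cos_Arg z Hiz Hz0).
    set (r := Cmod z) in *. set (th := Arg z) in *.
    assert (Hsin : sin th < sin e).
    { assert (E1 : k * sin th = r * (PI - th)).
      { rewrite <- EA, Esin. field. lra. }
      apply Rmult_lt_reg_l with k; [exact Hk|]. rewrite E1.
      apply Rle_lt_trans with (r * PI); [apply Rmult_le_compat_l; lra|].
      apply Rlt_le_trans with (k * sin e / PI * PI).
      - apply Rmult_lt_compat_r; assumption.
      - right. field. lra. }
    rewrite Rminus_0_r, Rabs_pos_eq by lra.
    apply Rlt_le_trans with e; [|apply Rmin_l].
    destruct (Rlt_le_dec th e) as [|Hth]; [assumption|exfalso].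
    (* [sin th < sin e] leaves only [th > PI - e]; there the pole gives
       [ln r - k * Re z / r ^ 2 >= ln r + k / (2 r) > ln (k / 2)] *)
    assert (Hth2 : PI - e < th).
    { destruct (Rlt_le_dec (PI - e) th) as [|H]; [assumption|exfalso].
      destruct (Rle_lt_dec th (PI / 2)) as [H'|H'].
      - apply (Rlt_not_le _ _ Hsin). apply sin_incr_1; lra.
      - apply (Rlt_not_le _ _ Hsin). rewrite <- (sin_PI_x th). apply sin_incr_1; lra. }
    assert (Hcos : 1 / 2 <= - cos th).
    { rewrite <- cos_PI3, <- (Rtrigo_facts.cos_pi_minus th). apply cos_decr_1; lra. }
    assert (Hre : Re z / r ^ 2 <= - (1 / 2) * / r).
    { replace (Re z / r ^ 2) with (cos th * / r) by (rewrite Ecos; field; lra).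
      apply Rmult_le_compat_r; [left; apply Rinv_0_lt_compat, Hr0 | lra]. }
    assert (Hre' : k * (Re z / r ^ 2) <= k * (- (1 / 2) * / r))
      by (apply Rmult_le_compat_l; lra).
    assert (Hk2 : 0 < k / 2) by lra.
    assert (Hir : 0 < / r) by (apply Rinv_0_lt_compat, Hr0).
    assert (Hln := ln_le_pred (k / 2 * / r) (Rmult_lt_0_compat _ _ Hk2 Hir)).
    rewrite ln_mult, ln_Rinv in Hln by assumption. lra.
  - intros eps Heps. exists 1. split; [lra|]. intros z _ Hz. lra.
Qed.

(** * Escaping to infinity *)

Lemma approaches_infinity_intro : forall (tau : Rbar) (gamma : R -> C),
  (forall M, 0 < M -> left_of tau (fun t => M < Cmod (gamma t))) ->
  approaches_infinity tau gamma.
Proof.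
  intros tau gamma H P [M HM].
  assert (HM1 : 0 < Rabs M + 1) by (generalize (Rabs_pos M); lra).
  unfold filtermap. generalize (H _ HM1). apply filter_imp. intros t Ht. apply HM.
  generalize (Rle_abs M). lra.
Qed.

(** Real translations do not change the asymptotic argument of a curve that tends to
    infinity. *)
Lemma Arg_shift_at_infinity :
  forall {T : Type} (F : (T -> Prop) -> Prop) {FF : Filter F} (gamma : T -> C) (q : R),
    (forall M, 0 < M -> F (fun t => M < Cmod (gamma t))) ->
    F (fun t => 0 <= Im (gamma t)) ->
    filterlim (fun t => Arg (gamma t - RtoC q)%C + -1 * Arg (gamma t)) F (locally 0).
Proof.
  intros T F FF gamma q Hinf Him. apply (lim_R F). intros eps Heps.
  destruct (Arg_close eps Heps) as [d [Hd Hclose]].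
  set (M := Rabs q + 1 + q ^ 2 / d).
  assert (Hq := Rabs_pos q).
  assert (Hqd : 0 <= q ^ 2 / d)
    by (apply Rmult_le_pos; [apply pow2_ge_0 | left; apply Rinv_0_lt_compat, Hd]).
  assert (HM : 0 < M) by (unfold M; lra).
  generalize (filter_and _ _ Him (Hinf M HM)). apply filter_imp. intros t [Hi Ht].
  assert (Hsh := Cmod_real_shift (gamma t) 0 q).
  rewrite Rminus_0_l, Rabs_Ropp in Hsh.
  replace (gamma t - RtoC 0)%C with (gamma t) in Hsh by ring.
  assert (H1 : 1 + q ^ 2 / d < Cmod (gamma t - RtoC q)%C) by (unfold M in Ht; lra).
  assert (H2 : 1 < Cmod (gamma t)) by (unfold M in Ht; lra).
  replace (Arg (gamma t - RtoC q)%C + -1 * Arg (gamma t) - 0)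
    with (Arg (gamma t - RtoC q)%C - Arg (gamma t)) by ring.
  apply Hclose.
  - rewrite Im_real_shift. exact Hi.
  - exact Hi.
  - apply Cmod_gt_0. lra.
  - apply Cmod_gt_0. lra.
  - replace (gamma t - RtoC q - gamma t)%C with (- RtoC q)%C by ring.
    rewrite Cmod_opp, Cmod_R, pow2_abs.
    assert (E : q ^ 2 = d * (q ^ 2 / d)) by (field; lra).
    rewrite E at 1. apply Rmult_lt_compat_l; [exact Hd|].
    apply Rlt_le_trans with (Cmod (gamma t - RtoC q)%C * 1); [lra|].
    apply Rmult_le_compat_l; lra.
Qed.

(** A curve on which [m log (z - q) + n log (z - q')], with positive weights, has real part
    tending to [+ oo] and imaginary part [m pi]. *)
Lemma escape_at_angle :
  forall (tau : Rbar) (gamma : R -> C) (X : R -> R) (q q' m n k : R),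
    0 < m -> 0 < n ->
    (forall t, before tau t ->
       0 <= Im (gamma t) /\ gamma t <> RtoC q /\ gamma t <> RtoC q' /\
       m * ln (Cmod (gamma t - RtoC q)%C) + n * ln (Cmod (gamma t - RtoC q')%C)
         = (m + n) * ln (X t) + k /\
       m * Arg (gamma t - RtoC q)%C + n * Arg (gamma t - RtoC q')%C = m * PI) ->
    (forall M, left_of tau (fun t => before tau t /\ M < X t)) ->
    approaches_infinity tau gamma /\
    filterlim (fun t => Arg (gamma t)) (left_of tau) (locally (PI * (m / (m + n)))).
Proof.
  intros tau gamma X q q' m n k Hm Hn Hcurve HX.
  assert (Hbefore : left_of tau (before tau)).
  { generalize (HX 0). apply filter_imp. intros t Ht; apply Ht. }
  assert (Hinf : forall M, 0 < M -> left_of tau (fun t => M < Cmod (gamma t))).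
  { intros M HM.
    set (K := m * ln (M + Rabs q) + n * ln (M + Rabs q')).
    generalize (HX (exp ((K - k) / (m + n)))). apply filter_imp. intros t [Ht HXt].
    destruct (Hcurve t Ht) as [_ [Hq [Hq' [Eln _]]]].
    destruct (Rlt_le_dec M (Cmod (gamma t))) as [|HMr]; [assumption|exfalso].
    assert (B : forall p, gamma t <> RtoC p ->
              ln (Cmod (gamma t - RtoC p)%C) <= ln (M + Rabs p)).
    { intros p Hp. apply ln_le; [apply Cmod_minus_pos, Hp|].
      eapply Rle_trans; [apply (Cmod_real_shift _ p 0)|].
      rewrite Rminus_0_r. replace (gamma t - RtoC 0)%C with (gamma t) by ring. lra. }
    assert (B1 : m * ln (Cmod (gamma t - RtoC q)%C) <= m * ln (M + Rabs q))
      by (apply Rmult_le_compat_l; [lra | apply B, Hq]).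
    assert (B2 : n * ln (Cmod (gamma t - RtoC q')%C) <= n * ln (M + Rabs q'))
      by (apply Rmult_le_compat_l; [lra | apply B, Hq']).
    assert (HlX : (K - k) / (m + n) < ln (X t)).
    { rewrite <- (ln_exp ((K - k) / (m + n))). apply ln_increasing; [apply exp_pos | assumption]. }
    assert (HlX' : K - k < (m + n) * ln (X t)).
    { apply Rle_lt_trans with ((m + n) * ((K - k) / (m + n))).
      - right. field. lra.
      - apply Rmult_lt_compat_l; [lra | assumption]. }
    unfold K in HlX'. lra. }
  assert (Him : left_of tau (fun t => 0 <= Im (gamma t))).
  { generalize Hbefore. apply filter_imp. intros t Ht. apply (Hcurve t Ht). }
  split; [apply approaches_infinity_intro, Hinf|].
  assert (L := Arg_shift_at_infinity (left_of tau) gamma q Hinf Him).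
  assert (L' := Arg_shift_at_infinity (left_of tau) gamma q' Hinf Him).
  apply filterlim_ext_loc with
    (fun t => / (m + n) * (m * PI +
       (- m * (Arg (gamma t - RtoC q)%C + -1 * Arg (gamma t))
        + - n * (Arg (gamma t - RtoC q')%C + -1 * Arg (gamma t))))).
  - generalize Hbefore. apply filter_imp. intros t Ht.
    destruct (Hcurve t Ht) as [_ [_ [_ [_ E]]]]. rewrite <- E. field. lra.
  - replace (PI * (m / (m + n))) with (/ (m + n) * (m * PI + (- m * 0 + - n * 0)))
      by (field; lra).
    apply (lim_scal (left_of tau)), (lim_plus (left_of tau)); [apply filterlim_const|].
    apply (lim_plus (left_of tau)); apply (lim_scal (left_of tau)); assumption.
Qed.

(** A curve on which [z + k log (z - k)] has imaginary part [k pi] and real part tending to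
    [+ oo]: the imaginary part stays bounded, so that the real part tends to [+ oo] and
    the argument to [0]. *)
Lemma escape_along_line :
  forall (tau : Rbar) (gamma : R -> C) (X : R -> R) (k : R),
    0 < k ->
    (forall t, before tau t ->
       0 <= Im (gamma t) /\ gamma t <> RtoC k /\
       Re (gamma t) + k * ln (Cmod (gamma t - RtoC k)%C) = X t /\
       Im (gamma t) + k * Arg (gamma t - RtoC k)%C = k * PI) ->
    (forall M, left_of tau (fun t => before tau t /\ M < X t)) ->
    approaches_infinity tau gamma /\
    asymptotic_to tau gamma (fun z : C => exists a : R, 0 < a /\ z = (a, PI * k)).
Proof.
  intros tau gamma X k Hk Hcurve HX. assert (Hpi := PI_RGT_0).
  assert (HIm : forall t, before tau t -> 0 <= Im (gamma t) <= k * PI).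
  { intros t Ht. destruct (Hcurve t Ht) as [Hi [_ [_ E]]]. split; [exact Hi|].
    assert (HA := Arg_bounds (gamma t - RtoC k)%C
                    ltac:(rewrite Im_real_shift; exact Hi)).
    assert (0 <= k * Arg (gamma t - RtoC k)%C) by (apply Rmult_le_pos; lra). lra. }
  assert (HRe : forall M, 0 < M -> left_of tau (fun t => before tau t /\ M < Re (gamma t))).
  { intros M HM. generalize (HX (2 * M + k * PI + k * ln k)). apply filter_imp.
    intros t [Ht HXt]. split; [exact Ht|].
    destruct (Hcurve t Ht) as [_ [Hn [E _]]]. assert (Hi := HIm t Ht).
    destruct (Rlt_le_dec M (Re (gamma t))) as [|HR]; [assumption|exfalso].
    assert (Hr := Cmod_minus_pos _ _ Hn).
    assert (Hb : Cmod (gamma t - RtoC k)%C <= Rabs (Re (gamma t)) + k * PI + k).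
    { eapply Rle_trans; [apply (Cmod_real_shift _ k 0)|].
      rewrite Rminus_0_r, (Rabs_pos_eq k) by lra.
      replace (gamma t - RtoC 0)%C with (gamma t) by ring.
      assert (Hz : Cmod (gamma t) <= Rabs (Re (gamma t)) + Rabs (Im (gamma t))).
      { apply Rsqr_incr_0_var; [|generalize (Rabs_pos (Re (gamma t))) (Rabs_pos (Im (gamma t))); lra].
        unfold Rsqr. assert (E2 := Cmod2_alt (gamma t)).
        rewrite <- (pow2_abs (Re _)), <- (pow2_abs (Im _)) in E2.
        generalize (Rmult_le_pos _ _ (Rabs_pos (Re (gamma t))) (Rabs_pos (Im (gamma t)))).
        nra. }
      rewrite (Rabs_pos_eq (Im (gamma t))) in Hz by lra. lra. }
    (* [k * ln r <= r - k + k * ln k], from [ln (r / k) <= r / k - 1] *)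
    assert (Hl : k * ln (Cmod (gamma t - RtoC k)%C)
                 <= Cmod (gamma t - RtoC k)%C - k + k * ln k).
    { assert (H := ln_le_pred (Cmod (gamma t - RtoC k)%C / k) ltac:(apply Rdiv_lt_0_compat; lra)).
      unfold Rdiv in H. rewrite ln_mult, ln_Rinv in H;
        [|exact Hk|exact Hr|apply Rinv_0_lt_compat, Hk].
      apply (Rmult_le_compat_l k) in H; [|lra].
      replace (k * (Cmod (gamma t - RtoC k)%C * / k - 1))
        with (Cmod (gamma t - RtoC k)%C - k) in H by (field; lra). lra. }
    unfold Rabs in Hb. destruct (Rcase_abs _) in Hb; lra. }
  split.
  - apply approaches_infinity_intro. intros M HM. generalize (HRe M HM).
    apply filter_imp. intros t [_ Ht].
    generalize (re_le_Cmod (gamma t)) (Rle_abs (Re (gamma t))). lra.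
  - intros eps Heps.
    assert (Hek : 0 < eps / k) by (apply Rdiv_lt_0_compat; assumption).
    destruct (Arg_close (eps / k) Hek) as [d [Hd Hclose]].
    assert (Hkd : 0 <= (k * PI) ^ 2 / d)
      by (apply Rmult_le_pos; [apply pow2_ge_0 | left; apply Rinv_0_lt_compat, Hd]).
    generalize (HRe (k + 1 + (k * PI) ^ 2 / d) ltac:(lra)). apply filter_imp.
    intros t [Ht HR]. assert (Hi := HIm t Ht).
    destruct (Hcurve t Ht) as [_ [Hn [_ E]]].
    set (z := (gamma t - RtoC k)%C) in *. set (u := Re (gamma t) - k).
    assert (Hu : 1 + (k * PI) ^ 2 / d < u) by (unfold u; lra).
    assert (Hzu : u <= Cmod z).
    { eapply Rle_trans; [|apply re_le_Cmod]. eapply Rle_trans; [|apply Rle_abs].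
      right. unfold z, u. simpl. unfold Re. ring. }
    assert (HA : Rabs (Arg z - Arg (RtoC u)) < eps / k).
    { apply Hclose.
      - unfold z. rewrite Im_real_shift. lra.
      - simpl. lra.
      - apply Cmod_gt_0. lra.
      - intros E0. apply (f_equal Re) in E0. simpl in E0. lra.
      - replace (z - RtoC u)%C with (Ci * RtoC (Im (gamma t)))%C
          by (apply injective_projections; unfold z, u, Re, Im; simpl; ring).
        rewrite Cmod_mult, Cmod_Ci, !Cmod_R, (Rabs_pos_eq u), Rmult_1_l by lra.
        rewrite pow2_abs.
        apply Rle_lt_trans with ((k * PI) ^ 2); [nra|].
        assert (E1 : (k * PI) ^ 2 = d * ((k * PI) ^ 2 / d)) by (field; lra).
        rewrite E1 at 1. apply Rmult_lt_compat_l; [exact Hd|].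
        apply Rlt_le_trans with (1 * u); [lra|]. apply Rmult_le_compat; lra. }
    rewrite Arg_pos_real, Rminus_0_r in HA by lra.
    exists ((Re (gamma t), (PI * k)%R) : C). split.
    + exists (Re (gamma t)). split; [lra | reflexivity].
    + replace (gamma t - (Re (gamma t), (PI * k)%R))%C with (Ci * RtoC (- (k * Arg z)))%C.
      * rewrite Cmod_mult, Cmod_Ci, Cmod_R, Rmult_1_l, Rabs_Ropp, Rabs_mult, (Rabs_pos_eq k) by lra.
        apply Rlt_le_trans with (k * (eps / k)); [apply Rmult_lt_compat_l; assumption|].
        right. field. lra.
      * apply injective_projections; simpl; unfold Re, Im in *; [ring | lra].
Qed.

Theorem corollary2 :
  forall (rho x0 : R) (tau : Rbar) (W x : R -> R) (gamma : R -> C),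
    0 < x0 ->
    SLE0 rho x0 tau W x gamma ->
    (rho <= -4 ->
       filterlim gamma (left_of tau) (locally (RtoC x0)) /\
       outer_hitting_angle tau gamma x0 (PI * ((4 + rho) / (2 + rho))) /\
       tau = Finite (- (x0 ^ 2 / (2 * (2 + rho))))) /\
    (-4 < rho < -2 ->
       filterlim gamma (left_of tau) (locally (RtoC (- (2 / (rho + 2)) * x0))) /\
       - (2 / (rho + 2)) * x0 > x0 /\
       outer_hitting_angle tau gamma (- (2 / (rho + 2)) * x0) (PI * ((4 + rho) / 2)) /\
       tau = Finite (- (x0 ^ 2 / (2 * (2 + rho))))) /\
    (rho = -2 ->
       approaches_infinity tau gamma /\
       asymptotic_to tau gamma
         (fun z : C => exists a : R, 0 < a /\ z = (a, PI * x0))) /\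
    (-2 < rho ->
       approaches_infinity tau gamma /\
       filterlim (fun t : R => Arg (gamma t)) (left_of tau)
         (locally (PI * ((2 + rho) / (4 + rho))))).
Proof.
  intros rho x0 tau W x gamma Hx0 HS.
  set (a := rho + 2). set (q' := - (2 / a) * x0).
  assert (Hgap : forall t, before tau t -> 0 < x t - W t)
    by exact (gap_positive rho x0 tau W x gamma Hx0 HS).
  assert (Hup : forall t, before tau t -> 0 <= Im (gamma t))
    by exact (tip_upper rho x0 tau W x gamma Hx0 HS).
  assert (Heq := trace_equation rho x0 tau W x gamma Hx0 HS). fold a in Heq.
  (* the value of the second logarithm at the tip *)
  assert (Hln2 : a <> 0 -> forall t, before tau t ->
            ln (Rabs (2 / a * (x t - W t))) = ln (Rabs (2 / a)) + ln (x t - W t)).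
  { intros Ha t Ht. assert (H := Hgap t Ht).
    rewrite Rabs_mult, (Rabs_pos_eq (x t - W t)) by lra.
    apply ln_mult; [|exact H]. apply Rabs_pos_lt. unfold Rdiv.
    apply Rmult_integral_contrapositive_currified; [lra | apply Rinv_neq_0_compat, Ha]. }
  assert (Hneg : a < 0 -> forall t, before tau t -> Arg (RtoC (2 / a * (x t - W t))) = PI).
  { intros Ha t Ht. apply Arg_neg_real. assert (H := Hgap t Ht).
    assert (/ a < 0) by (apply Rinv_lt_0_compat, Ha). unfold Rdiv. nra. }
  split; [|split; [|split]].
  - intros Hrho. assert (Ha : a < 0) by (unfold a; lra).
    assert (HX := gap_tends_to_0 rho x0 tau W x gamma Hx0 HS Ha).
    assert (Htau := lifetime_finite rho x0 tau W x gamma Hx0 HS Ha).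
    destruct (Req_dec rho (-4)) as [E4|N4].
    + destruct (landing_pole tau gamma (fun t => x t - W t) x0 x0 Hx0) as [H1 H2].
      * intros t Ht. split; [apply Hgap, Ht | split; [apply Hup, Ht|]].
        apply (trace_equation_am2 rho x0 tau W x gamma Hx0 HS t Ht). lra.
      * exact HX.
      * split; [exact H1 | split; [|exact Htau]].
        replace (PI * ((4 + rho) / (2 + rho))) with 0 by (rewrite E4; field; lra).
        exact H2.
    + destruct (landing tau gamma (fun t => x t - W t) x0 q' (- a) (- (2))
                  (- (2 * ln (Rabs (2 / a))))) as [H1 H2].
      * lra.
      * lra.
      * unfold a; lra.
      * unfold q'. apply Rmult_lt_reg_r with (- a); [lra|].
        replace (- (2 / a) * x0 * - a) with (2 * x0) by (field; lra).
        unfold a in *. nra.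
      * intros t Ht. destruct (Heq t Ht) as [Hq [Hq' [Eln EA]]]; [lra | unfold a; lra|].
        fold q' in Hq', Eln, EA. rewrite (Hln2 ltac:(lra) t Ht) in Eln.
        rewrite (Hneg Ha t Ht) in EA.
        repeat split; try assumption; [apply Hgap, Ht | apply Hup, Ht | lra | lra].
      * exact HX.
      * split; [exact H1 | split; [|exact Htau]].
        replace (PI * ((4 + rho) / (2 + rho))) with (PI * ((- a + - (2)) / - a)); [exact H2|].
        unfold a. field. unfold a in Ha. lra.
  - intros Hrho. assert (Ha : a < 0) by (unfold a; lra).
    assert (HX := gap_tends_to_0 rho x0 tau W x gamma Hx0 HS Ha).
    assert (Htau := lifetime_finite rho x0 tau W x gamma Hx0 HS Ha).
    assert (Hqx : x0 < q').
    { unfold q'. apply Rmult_lt_reg_r with (- a); [lra|].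
      replace (- (2 / a) * x0 * - a) with (2 * x0) by (field; lra).
      unfold a in *. nra. }
    destruct (landing tau gamma (fun t => x t - W t) q' x0 2 a
                (2 * ln (Rabs (2 / a)))) as [H1 H2].
    + lra.
    + exact Ha.
    + unfold a; lra.
    + exact Hqx.
    + intros t Ht. destruct (Heq t Ht) as [Hq [Hq' [Eln EA]]]; [lra | unfold a; lra|].
      fold q' in Hq', Eln, EA. rewrite (Hln2 ltac:(lra) t Ht) in Eln.
      rewrite (Hneg Ha t Ht) in EA.
      repeat split; try assumption; [apply Hgap, Ht | apply Hup, Ht | lra | lra].
    + exact HX.
    + split; [exact H1 | split; [exact Hqx | split; [|exact Htau]]].
      replace (PI * ((4 + rho) / 2)) with (PI * ((2 + a) / 2)) by (unfold a; field).
      exact H2.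
  - intros Hrho. assert (Ha : a = 0) by (unfold a; lra).
    apply (escape_along_line tau gamma (fun t => x0 * ln x0 + 2 / x0 * t)).
    + exact Hx0.
    + intros t Ht. split; [apply Hup, Ht|].
      apply (trace_equation_a0 rho x0 tau W x gamma Hx0 HS t Ht Ha).
    + intros M.
      assert (Etau : tau = p_infty)
        by (apply (lifetime_infinite rho x0 tau W x gamma Hx0 HS); fold a; lra).
      enough (H : left_of p_infty (fun t => before tau t /\ M < x0 * ln x0 + 2 / x0 * t))
        by (rewrite <- Etau in H; exact H).
      apply left_of_infinite. exists (Rmax 0 (x0 / 2 * (M - x0 * ln x0))).
      intros t Ht.
      assert (M1 := Rmax_l 0 (x0 / 2 * (M - x0 * ln x0))).
      assert (M2 := Rmax_r 0 (x0 / 2 * (M - x0 * ln x0))).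
      split; [rewrite Etau; split; [lra | exact I]|].
      assert (H : 2 / x0 * (x0 / 2 * (M - x0 * ln x0)) < 2 / x0 * t)
        by (apply Rmult_lt_compat_l; [apply Rdiv_lt_0_compat; lra | lra]).
      replace (2 / x0 * (x0 / 2 * (M - x0 * ln x0))) with (M - x0 * ln x0) in H
        by (field; lra). lra.
  - intros Hrho. assert (Ha : 0 < a) by (unfold a; lra).
    replace (PI * ((2 + rho) / (4 + rho))) with (PI * (a / (a + 2)))
      by (unfold a; field; lra).
    apply (escape_at_angle tau gamma (fun t => x t - W t) x0 q' a 2
             (2 * ln (Rabs (2 / a)))).
    + exact Ha.
    + lra.
    + intros t Ht. destruct (Heq t Ht) as [Hq [Hq' [Eln EA]]]; [lra | unfold a; lra|].
      fold q' in Hq', Eln, EA. rewrite (Hln2 ltac:(lra) t Ht) in Eln.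
      rewrite Arg_pos_real in EA.
      * repeat split; try assumption; [apply Hup, Ht | lra | lra].
      * apply Rmult_lt_0_compat; [apply Rdiv_lt_0_compat; lra | apply Hgap, Ht].
    + exact (gap_tends_to_infinity rho x0 tau W x gamma Hx0 HS Ha).
Qed.
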